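(* For all $n\ge1$ and $0\le j\le n$: (1) the polynomial $\sum_{\pi\in C_l\wr\mathfrak{S}_n,\ \mathrm{fix}(\pi)=j}t^{\mathrm{fexc}(\pi)}q^{(\mathrm{maj}-\mathrm{exc})\pi}$ is $t$-symmetric and $t$-unimodal with center of symmetry $\frac{l(n-j)}{2}$; (2) $A_n^{(l)}(t,q)=\sum_{\pi\in C_l\wr\mathfrak{S}_n}t^{\mathrm{fexc}(\pi)}q^{(\mathrm{maj}-\mathrm{exc})\pi}$ is $t$-symmetric and $t$-unimodal with center of symmetry $\frac{ln-1}{2}$. Here coefficients in $\mathbb{Q}[q]$ are ordered by $f\le_q g$ iff $g-f$ has nonnegative coefficients.
   Context: $C_l\wr\mathfrak{S}_n$ is the set of words $\pi=\pi_1\cdots\pi_n$ with $\pi_i=|\pi_i|^{\epsilon_i}$, $\epsilon_i\in\{0,\dots,l-1\}$, $|\pi_1|\cdots|\pi_n|\in\mathfrak{S}_n$. Order colored integers by $u^a<v^b$ iff $a>b$, or $a=b$ and $u<v$. $\mathrm{maj}(\pi)=\sum\{i\in[n-1]:\pi_i>\pi_{i+1}\}$; $\mathrm{exc}(\pi)$ is the number of $i$ with $\epsilon_i=0$ and $|\pi_i|>i$; $\mathrm{fexc}(\pi)=l\,\mathrm{exc}(\pi)+\sum_i\epsilon_i$; $\mathrm{fix}(\pi)=|\{i:\pi_i=i^0\}|$. A nonzero polynomial $\sum_{i=r}^sa_it^i$ ($a_r,a_s\ne0$) is $t$-symmetric with center $\frac{r+s}2$ if $a_{r+k}=a_{s-k}$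 for all $k$, and $t$-unimodal if $a_r\le_q\cdots\le_q a_{\lfloor(r+s)/2\rfloor}$ and $a_{\lfloor(r+s+1)/2\rfloor}\ge_q\cdots\ge_q a_s$.
   Formalization: In (1) the case l = 1, j = n−1 is excluded: no permutation in S_n has exactly n−1 fixed points, so the polynomial is zero there, and t-symmetry is defined only for nonzero polynomials. *)

(* Defs.v *)
From mathcomp Require Import all_boot all_order fingroup perm ssralg ssrint.
Set Implicit Arguments. Unset Strict Implicit. Unset Printing Implicit Defensive.

(* A colored permutation pi in C_l wr S_n, with positions 0..n-1 standing for
   1..n: pi_(i+1) = (s i + 1)^(c i). *)
Definition cperm (n l : nat) : finType := ({perm 'I_n} * {ffun 'I_n -> 'I_l})%type.

Section Stats.
Variables n l : nat.
Implicit Types p : cperm n l.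

Definition absv p (i : 'I_n) : nat := (p.1 i).+1.
Definition colr p (i : 'I_n) : nat := p.2 i.

Definition clt (x y : nat * nat) : bool :=
  (y.2 < x.2) || ((x.2 == y.2) && (x.1 < y.1)).

Definition cdes p (i : 'I_n) : bool :=
  match insub i.+1 : option 'I_n with
  | Some j => clt (absv p j, colr p j) (absv p i, colr p i)
  | None => false
  end.

Definition cmaj p : nat := \sum_(i < n | cdes p i) i.+1.
Definition cexc p : nat := #|[set i : 'I_n | (colr p i == 0) && (absv p i > i.+1)]|.
Definition cfexc p : nat := l * cexc p + \sum_(i < n) colr p i.
Definition cfix p : nat := #|[set i : 'I_n | (colr p i == 0) && (absv p i == i.+1)]|.

Definition coef_fix (j k : nat) (e : int) : nat :=
  #|[set p : cperm n l | [&& cfix p == j, cfexc p == k & (Posz (cmaj p) - Posz (cexc p))%R == e]]|.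
Definition coef_A (k : nat) (e : int) : nat :=
  #|[set p : cperm n l | (cfexc p == k) && ((Posz (cmaj p) - Posz (cexc p))%R == e)]|.
End Stats.

(* A polynomial in t with coefficients in Z[q] (or Z[q,q^-1]) is encoded by
   a : nat -> int -> nat, where a k e is the coefficient of t^k q^e.
   (All coefficients here are natural numbers.)  f <=_q g iff g - f has
   nonnegative coefficients, i.e. pointwise <=. *)
Definition leq_q (f g : int -> nat) : Prop := forall e, f e <= g e.
Definition eq_q (f g : int -> nat) : Prop := forall e, f e = g e.
Definition nzq (f : int -> nat) : Prop := exists e, f e <> 0.

Definition tdeg_range (a : nat -> int -> nat) (r s : nat) : Prop :=
  [/\ r <= s, nzq (a r), nzq (a s) &
      forall k, (k < r \/ s < k) -> forall e, a k e = 0].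

(* t-symmetric with center c2/2 *)
Definition t_symmetric (a : nat -> int -> nat) (c2 : nat) : Prop :=
  exists r s, [/\ tdeg_range a r s, r + s = c2 &
                  forall k, k <= s - r -> eq_q (a (r + k)) (a (s - k))].

Definition t_unimodal (a : nat -> int -> nat) : Prop :=
  exists r s, [/\ tdeg_range a r s,
     (forall k, r <= k -> k < (r + s)./2 -> leq_q (a k) (a k.+1)) &
     (forall k, (r + s).+1./2 <= k -> k < s -> leq_q (a k.+1) (a k))].

(* Main.v *)
(* Let D_n be the polynomial of the colored permutations without fixed points.  The proof
   rests on the recursions (with q-binomial coefficients and [m]_t = 1 + t + ... + t^(m-1))
     sum over fix = j:  [n choose j]_q D_(n-j),
     D_n = sum_(k >= 1) [n choose k]_q t [l k - 1]_t D_(n-k),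
     A_n = sum_(k >= 1) [n choose k]_q [l k]_t D_(n-k),
   from which symmetry and unimodality follow, since multiplying by [m]_t preserves them.
   The recursions amount to the generating function
     sum_n A_n(t, r, q) z^n / (q; q)_n = (1 - t) e(r z) / (e(t^l z) - t e(z)),
   where r marks fixed points and e(z) = sum_n z^n / (q; q)_n.  MacMahon's Verfahren turns
   its left side into a sum over pairs of a permutation and a weakly decreasing sequence b
   such that the permutation is increasing on the fibers of b.  Standardization turns the
   pairs into words, and excedances into inequalities between the letter at a position and
   the letter at this position in the sorted word.  The resulting sum is that of MacMahon's
   master theorem and is computed by eliminating the letters one at a time.  Formal power
   series in z and q are replaced by rings in which z and q are nilpotent. *)
Require Import Defs.
From mathcomp Require Import all_boot all_order fingroup perm ssralg ssrint.
From mathcomp Require Import all_algebra zify ring.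
Set Implicit Arguments. Unset Strict Implicit. Unset Printing Implicit Defensive.
Import GRing.Theory.

(** * Iterated polynomial rings and coefficient extraction *)

Section Tower.
Local Open Scope ring_scope.
Variable R : comNzRingType.

(** The variables are nested so that the top one can be eliminated by univariate arguments over the
    ring of the others. *)
Fixpoint mpol N : comNzRingType := if N is N'.+1 then {poly (mpol N')} else R.

Fixpoint mcst N : {rmorphism R -> mpol N} :=
  match N return {rmorphism R -> mpol N} with
  | 0 => idfun
  | N'.+1 => polyC \o mcst N'
  end.

Fixpoint mvar N (A : nat) : mpol N :=
  match N return mpol N with
  | 0 => 0
  | N'.+1 => if A == N' then 'X else (mvar N' A)%:P
  end.

(* The exponent of the top variable comes first. *)
Fixpoint mext N (m : seq nat) : mpol N -> R :=
  match N return mpol N -> R with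
  | 0 => fun P => P
  | N'.+1 => fun P => mext (behead m) P`_(head 0%N m)
  end.

Arguments mext : clear implicits.

Lemma mextD N m : {morph mext N m : P Q / P + Q}.
Proof. by elim: N m => [|N IH] m P Q //=; rewrite coefD IH. Qed.

Lemma mext0 N m : mext N m 0 = 0.
Proof. by elim: N m => [|N IH] m //=; rewrite coef0 IH. Qed.

Lemma mext_sum N m I (r : seq I) (C : pred I) (f : I -> mpol N) :
  mext N m (\sum_(i <- r | C i) f i) = \sum_(i <- r | C i) mext N m (f i).
Proof. exact: (big_morph (mext N m) (@mextD N m) (mext0 N m)). Qed.

Lemma mextZ N m c P : mext N m (mcst N c * P) = c * mext N m P.
Proof. by elim: N m P => [|N IH] m P //=; rewrite coefCM IH. Qed.

Definition lform N (a : nat -> R) : mpol N :=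
  \sum_(A < N) mcst N (a A) * mvar N A.

Lemma lformS N a :
  lform N.+1 a = (lform N a)%:P + (mcst N (a N))%:P * 'X.
Proof.
rewrite /lform big_ord_recr /= eqxx; congr (_ + _).
rewrite rmorph_sum; apply: eq_bigr => A _ /=.
by rewrite ltn_eqF // polyCM.
Qed.

Lemma eq_lform N a a' : (forall A, A < N -> a A = a' A)%N -> lform N a = lform N a'.
Proof. by move=> e; apply: eq_bigr => A _; rewrite e. Qed.

Lemma lformZ N c a : lform N (fun A => c * a A) = mcst N c * lform N a.
Proof.
by rewrite mulr_sumr; apply: eq_bigr => A _; rewrite rmorphM mulrA.
Qed.

Lemma lformD N a a' : lform N (fun A => a A + a' A) = lform N a + lform N a'.
Proof.
by rewrite -big_split; apply: eq_bigr => A _; rewrite rmorphD mulrDl.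
Qed.

End Tower.

Arguments mext {R} N m P.
Arguments mcst {R} N.
Arguments mvar {R} N A.
Arguments lform {R} N a.

(** * Sums over block sizes and elimination of one letter *)

Section Blocks.
Local Open Scope ring_scope.

(* Weighs the words of length [k] in which a letter of weight [x] is barred from one
   extreme position. *)
Definition gblock (S : comNzRingType) (L x : S) k : S :=
  if k is k'.+1 then (L - x) * L ^+ k' else 1.

Fixpoint gprod (S : comNzRingType) (L x : nat -> S) (m : seq nat) : S :=
  if m is k :: m' then gblock (L (size m')) (x (size m')) k * gprod L x m' else 1.

Lemma rmorph_gprod (S T : comNzRingType) (f : {rmorphism S -> T}) L x m :
  f (gprod L x m) = gprod (f \o L) (f \o x) m.
Proof.
elim: m => [|k m IH] /=; first by rewrite rmorph1.
rewrite rmorphM IH; congr (_ * _).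
by case: k => [|k] /=; rewrite ?rmorph1 // rmorphM rmorphXn rmorphB.
Qed.

Lemma eq_gprod (S : comNzRingType) (L L' x x' : nat -> S) m :
  (forall B, B < size m -> L B = L' B)%N -> (forall B, B < size m -> x B = x' B)%N ->
  gprod L x m = gprod L' x' m.
Proof.
elim: m => [|k m IH] //= eL ex; rewrite eL // ex // IH // => B lB.
  by rewrite eL // ltnW.
by rewrite ex // ltnW.
Qed.

(* [s Q := \sum_(k < K) (L ^+ k * Q)`_k] satisfies [s ('X * Q) = s (L * Q)], so it acts
   as the evaluation of [Q] at the solution of [X = L]. *)
Lemma lagrange_eval (S : comNzRingType) (K : nat) (a Y i : S) (Q : {poly S}) :
  let L := a%:P * 'X + Y%:P in L ^+ K = 0 -> (1 - a) * i = 1 ->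
  \sum_(k < K.+1) (L ^+ k * Q)`_k = i * Q.[i * Y].
Proof.
move=> L LK ia.
pose s Q := \sum_(k < K.+1) (L ^+ k * Q)`_k.
have sD P P' : s (P + P') = s P + s P'.
  by rewrite /s -big_split /=; apply: eq_bigr => k _; rewrite mulrDr coefD.
have sZ c P : s (c%:P * P) = c * s P.
  by rewrite /s mulr_sumr; apply: eq_bigr => k _; rewrite mulrCA coefCM.
have szL k : (size (L ^+ k) <= k.+1)%N.
  apply: leq_trans (size_poly_exp_leq _ _) _; rewrite ltnS.
  have : (size L <= 2)%N.
    rewrite (leq_trans (size_polyD _ _)) // geq_max.
    have c1 c : (size (c%:P : {poly S}) <= 1)%N := size_polyC_leq1 c.
    rewrite (leq_trans (c1 _)) // andbT (leq_trans (size_polyMleq _ _)) // size_polyX addn2.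
    by rewrite ltnS c1.
  by case: (size L) => [|[|[|]]] //=; rewrite ?mul0n ?mul1n.
(* Since [L ^+ k] has degree at most [k], this is its top coefficient. Hence [L ^+ K = 0] makes [a]
   nilpotent, and [s 1] is the geometric series of [a]. *)
have top k : (L ^+ k)`_k = a ^+ k.
  elim: k => [|k IH]; first by rewrite !expr0 coef1.
  rewrite exprS mulrDl coefD -mulrA coefCM coefXM /= IH coefCM.
  by rewrite (nth_default _ (szL k)) mulr0 addr0 exprS.
have aK : a ^+ K = 0 by rewrite -top LK coef0.
have s1 : s 1 = i.
  have -> : s 1 = \sum_(k < K.+1) a ^+ k by apply: eq_bigr => k _; rewrite mulr1 top.
  have := subrX1 a K.+1; rewrite exprS aK mulr0 sub0r => e.
  rewrite -[LHS]mul1r -ia [_ * i]mulrC -mulrA -[1 - a]opprB mulNr -e opprK mulr1.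
  done.
have sX P : s ('X * P) = i * Y * s P.
  have e : s ('X * P) = s (L * P).
    rewrite /s big_ord_recl mulrCA coefXM /= add0r big_ord_recr /= LK mul0r coef0 addr0.
    apply: eq_bigr => k _.
    by rewrite mulrCA coefXM /= exprSr -mulrA.
  have e2 : s ('X * P) = a * s ('X * P) + Y * s P.
    by rewrite {1}e mulrDl sD -mulrA !sZ.
  rewrite -[LHS]mul1r -ia; move: e2; move: (s ('X * P)) (s P) => x y e2.
  have -> : (1 - a) * i * x = i * (x - a * x) by ring.
  by rewrite [X in X - _]e2 addrAC subrr add0r mulrA.
change (s Q = i * Q.[i * Y]).
elim/poly_ind: Q => [|Q c IH].
  by rewrite horner0 mulr0 /s big1 // => k _; rewrite mulr0 coef0.
rewrite sD mulrC sX IH -{1}[c%:P]mulr1 sZ s1 [in RHS]mulrC hornerD hornerM hornerX hornerC. ring.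
Qed.

(** The coefficient of degree [k.+1] in ['X * L ^+ k * Q] is the term of index [k] of the sum in
    [lagrange_eval], so barring the letter from one position costs a factor [1 - o]. *)
Lemma lagrange_gblock (S : comNzRingType) (K : nat) (a Y i o : S) (Q : {poly S}) :
  let L := a%:P * 'X + Y%:P in L ^+ K = 0 -> (1 - a) * i = 1 ->
  \sum_(k < K.+1) (gblock L (o%:P * 'X) k * Q)`_k = (1 - o) * (i * Q.[i * Y]).
Proof.
move=> L LK ia; rewrite -(lagrange_eval Q LK ia) mulrBl mul1r.
rewrite [X in _ = X - _]big_ord_recl [X in o * X]big_ord_recr.
rewrite (_ : (L ^+ K * Q)`_K = 0) ?LK ?mul0r ?coef0 //.
rewrite [LHS]big_ord_recl /= addr0.
rewrite -[RHS]addrA; congr (_ + _); rewrite mulr_sumr -sumrB; apply: eq_bigr => k _ /=.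
rewrite add0n mulrBl mulrBl coefB -exprS; congr (_ - _).
by rewrite -!mulrA coefCM coefXM.
Qed.

Fixpoint mlists K N : seq (seq nat) :=
  if N is N'.+1 then [seq k :: m | k <- iota 0 K, m <- mlists K N'] else [:: [::]].

Lemma mem_mlists K N m : (m \in mlists K N) = (size m == N) && all (fun k => k < K)%N m.
Proof.
elim: N m => [|N IH] m /=; first by rewrite mem_seq1; case: m.
apply/allpairsP/idP => [[[k m'] /= [kK mm ->]]|].
  by move: mm kK; rewrite IH mem_iota /= eqSS => /andP[-> ->]; rewrite andbT.
case: m => //= k m; rewrite eqSS => /and3P[sm kK am].
by exists (k, m); rewrite /= IH sm am mem_iota.
Qed.

Lemma uniq_mlists K N : uniq (mlists K N).
Proof.
elim: N => [|N IH] //=; apply: allpairs_uniq => //; first exact: iota_uniq.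
by move=> [k m] [k' m'] _ _ /= [-> ->].
Qed.

(* The sum over [m] of the coefficient of [x ^ m] in [\prod_B L_B ^ m_B], where
   [L_B = \sum_A a B A * x_A], as in MacMahon's master theorem, except that one factor [L_B]
   of each block loses the term [o B * x_B]. *)
Definition msum (R : comNzRingType) K N (a : nat -> nat -> R) (o : nat -> R) : R :=
  \sum_(m <- mlists K N)
     mext N m (gprod (fun B => lform N (a B)) (fun B => mcst N (o B) * mvar N B) m).

Lemma eq_msum (R : comNzRingType) K N (a a' : nat -> nat -> R) o o' :
  (forall B A, B < N -> A < N -> a B A = a' B A)%N ->
  (forall B, B < N -> o B = o' B)%N ->
  msum K N a o = msum K N a' o'.
Proof.
move=> ea eo; rewrite /msum !big_seq; apply: eq_bigr => m.
rewrite mem_mlists => /andP[/eqP sm _]; congr mext; apply: eq_gprod => B; rewrite sm => lB.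
  by apply: eq_lform => A lA; rewrite ea.
by rewrite eo.
Qed.

(* Eliminates the top letter: [x_N] is replaced by the solution of [x_N = L_N]. *)
Lemma msum_step (R : comNzRingType) K N (z i : R) (b : nat -> nat -> R) (o : nat -> R) :
  z ^+ K = 0 -> (1 - z * b N N) * i = 1 ->
  (1 - z * b N N) * msum K.+1 N.+1 (fun B A => z * b B A) o =
  (1 - o N) * msum K.+1 N (fun B A => z * (b B A + b B N * (z * i * b N A))) o.
Proof.
move=> zK iN; rewrite /msum big_allpairs_dep /=.
rewrite [in LHS]exchange_big /= [in LHS]big_seq [in RHS]big_seq !mulr_sumr.
apply: eq_bigr => m; rewrite mem_mlists => /andP[/eqP sm _].
rewrite -[0%N :: iota 1 K]/(index_iota 0 K.+1) big_mkord -mext_sum.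
set Q := gprod _ _ m; rewrite sm eqxx.
have -> : lform N.+1 (fun A => z * b N A) =
    (mcst N (z * b N N))%:P * 'X + (lform N (fun A => z * b N A))%:P.
  by rewrite lformS addrC.
rewrite (@lagrange_gblock _ K _ _ (mcst N i)); first last.
- by rewrite -(rmorph1 (mcst N)) -rmorphB -rmorphM iN rmorph1.
- have -> : (mcst N (z * b N N))%:P * 'X + (lform N (fun A => z * b N A))%:P =
    mcst N.+1 z * lform N.+1 (b N).
    by rewrite -lformZ lformS addrC.
  by rewrite exprMn_comm; [rewrite -rmorphXn zK rmorph0 mul0r | apply: mulrC].
rewrite -(rmorph1 (mcst N)) -rmorphB !mextZ mulrCA; congr (_ * _).
rewrite mulrA iN mul1r; congr mext.
(* The substituted value is a linear form in the lower letters, so the lower forms stay linear and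
   only their coefficients change. *)
rewrite -[LHS]/(horner_eval _ Q) rmorph_gprod; apply: eq_gprod => B; rewrite sm => lB /=.
  rewrite lformS /horner_eval hornerD hornerM hornerX !hornerC lformZ.
  rewrite !lformZ lformD lformZ lformZ !rmorphM /=; ring.
by rewrite /horner_eval ltn_eqF // hornerM !hornerC.
Qed.

End Blocks.

(** * Elimination of all letters for the matrix of excedances *)

Section Elimination.
Local Open Scope ring_scope.
Variables (R : comNzRingType) (K : nat) (z : R).
Hypothesis zK : z ^+ K = 0.

Lemma inv_one_sub (b : R) : exists i, (1 - z * b) * i = 1.
Proof.
exists (\sum_(k < K) (z * b) ^+ k).
by rewrite -opprB mulNr -subrX1 exprMn zK mul0r sub0r opprK.
Qed.

(* Letter [3 * k + d] stands for the value [k] at an excedance (d = 0), a fixed point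
   (d = 1) or an anti-excedance (d = 2). *)
Variables (y r u : nat -> R).

Definition letter_wt (A : nat) : R :=
  match (A %% 3)%N with
  | 0 => y (A %/ 3)
  | 1 => r (A %/ 3)
  | _ => u (A %/ 3)
  end.

(** A class of matrices stable under elimination of the top letter, which changes only [c]; the
    initial matrix has [c = 0]. *)
Definition bmat (c : R) (B A : nat) : R :=
  match (A %% 3)%N with
  | 0 => (B <= A)%N%:R * y (A %/ 3)
  | 1 => (B == A)%N%:R * r (A %/ 3)
  | _ => (c + (A <= B)%N%:R) * u (A %/ 3)
  end.

(** The diagonal weight at [c = 0] for letters of excedances and anti-excedances: each of their
    blocks has one position where the letter may not stand over itself. *)
Definition ends (B : nat) : R :=
  match (B %% 3)%N with
  | 0 => z * y (B %/ 3)
  | 1 => 0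
  | _ => z * u (B %/ 3)
  end.

Definition bsum N c := msum K.+1 N (fun B A => z * bmat c B A) ends.

(** Among the remaining letters, the column of the eliminated one is constant and its row is
    supported on the anti-excedance letters, so the correction of the matrix amounts to a change of
    [c]. The same holds in the next two lemmas. *)
Lemma bsum_minus k c i : (1 - z * u k * (1 + c)) * i = 1 ->
  (1 - z * u k * (1 + c)) * bsum (k * 3 + 3) c =
  (1 - z * u k) * bsum (k * 3 + 2) (c + c * u k * z * i * (1 + c)).
Proof.
move=> ui; rewrite /bsum addnS.
have m3 : ((k * 3 + 2) %% 3 = 2)%N by lia.
have d3 : ((k * 3 + 2) %/ 3 = k)%N by lia.
have bN : bmat c (k * 3 + 2) (k * 3 + 2) = (1 + c) * u k.
  by rewrite /bmat m3 d3 leqnn addrC.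
have -> : z * u k * (1 + c) = z * bmat c (k * 3 + 2) (k * 3 + 2) by rewrite bN; ring.
rewrite (msum_step (i := i)) //; last by rewrite bN -[RHS]ui; ring.
rewrite /ends m3 d3; congr (_ * _); apply: eq_msum => // B A lB lA; congr (_ * _).
rewrite {1 3 4}/bmat; have -> : bmat c B (k * 3 + 2) = c * u k.
  by rewrite /bmat m3 d3 leqNgt lB addr0.
have := ltn_pmod A (isT : 0 < 3)%N; case: (A %% 3)%N => [|[|[|//]]] _.
- by rewrite [(k * 3 + 2 <= A)%N]leqNgt lA /=; ring.
- by rewrite [(k * 3 + 2 == A)%N]gtn_eqF //=; ring.
by rewrite [(A <= k * 3 + 2)%N]ltnW //=; ring.
Qed.

Lemma bsum_zero k c i : (1 - z * r k) * i = 1 ->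
  (1 - z * r k) * bsum (k * 3 + 2) c = bsum (k * 3 + 1) c.
Proof.
move=> ui; rewrite /bsum addnS.
have m3 : ((k * 3 + 1) %% 3 = 1)%N by lia.
have d3 : ((k * 3 + 1) %/ 3 = k)%N by lia.
have bN : bmat c (k * 3 + 1) (k * 3 + 1) = r k.
  by rewrite /bmat m3 d3 eqxx mul1r.
rewrite -{1}bN (msum_step (i := i)) //; last by rewrite bN -[RHS]ui; ring.
rewrite {1}/ends m3 subr0 mul1r; apply: eq_msum => // B A lB lA; congr (_ * _).
have -> : bmat c B (k * 3 + 1) = 0.
  by rewrite /bmat m3 ltn_eqF // mul0r.
by rewrite mul0r addr0.
Qed.

Lemma bsum_plus k c i : (1 - z * y k) * i = 1 ->
  (1 - z * y k) * bsum (k * 3 + 1) c =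
  (1 - z * y k) * bsum (k * 3) (c + y k * z * i * (1 + c)).
Proof.
move=> ui; rewrite /bsum addn1.
have m3 : ((k * 3) %% 3 = 0)%N by lia.
have d3 : ((k * 3) %/ 3 = k)%N by lia.
have bN : bmat c (k * 3) (k * 3) = y k.
  by rewrite /bmat m3 d3 leqnn mul1r.
rewrite -{1}bN (msum_step (i := i)) //; last by rewrite bN -[RHS]ui; ring.
rewrite {1}/ends m3 d3; congr (_ * _); apply: eq_msum => // B A lB lA; congr (_ * _).
have -> : bmat c B (k * 3) = y k by rewrite /bmat m3 d3 ltnW // mul1r.
rewrite /bmat; have := ltn_pmod A (isT : 0 < 3)%N; case: (A %% 3)%N => [|[|[|//]]] _.
- by rewrite [(k * 3 <= A)%N]leqNgt lA /=; ring.
- by rewrite [(k * 3 == A)%N]gtn_eqF //=; ring.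
by rewrite [(A <= k * 3)%N]ltnW //=; ring.
Qed.

(* Eliminating the letters from the top down changes [c]; [d] is the product of the
   pivots met so far, up to those of the fixed points, and [g = d * (1 + c)]. *)
Fixpoint pivots k (d g : R) : R :=
  if k is k'.+1 then
    pivots k' ((d - g * (z * u k')) * (1 - z * y k')) (g * (1 - z * u k'))
  else d.

(** Although [c] evolves by fractions, each round multiplies [1 + c] by [1 - z * u k] and divides it
    by the two pivots that enter [d]. So [d] and [g] follow polynomial recursions. *)
Lemma pivots_bsum k c d g di : g = d * (1 + c) -> d * di = 1 ->
  (exists i, pivots k d g * i = 1) /\
  pivots k d g * \prod_(j < k) (1 - z * r j) * bsum (k * 3) c =
    d * \prod_(j < k) ((1 - z * u j) * (1 - z * y j)).
Proof.
elim: k c d g di => [|k IH] c d g di eg ed.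
  split; first by exists di.
  by rewrite !big_ord0 !mulr1 /= /bsum /msum big_seq1 mulr1.
have [i1 e1] := inv_one_sub (u k * (1 + c)).
have [i2 e2] := inv_one_sub (r k); have [i3 e3] := inv_one_sub (y k).
have e1' : (1 - z * u k * (1 + c)) * i1 = 1 by rewrite -mulrA.
set c1 := c + c * u k * z * i1 * (1 + c).
set c2 := c1 + y k * z * i3 * (1 + c1).
have s1 := bsum_minus e1'; have s2 := bsum_zero c1 e2; have s3 := bsum_plus c1 e3.
rewrite -/c1 in s1; rewrite -/c2 in s3.
have [p1 ep1] : exists p, p = 1 - z * u k * (1 + c) by eexists.
rewrite -ep1 in s1 e1'.
have c1E : p1 * (1 + c1) = (1 + c) * (1 - z * u k).
  have -> : p1 * (1 + c1) = p1 * (1 + c) + (p1 * i1) * (c * u k * z * (1 + c)).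
    by rewrite /c1; ring.
  by rewrite e1' ep1; ring.
have c2E : (1 - z * y k) * (1 + c2) = 1 + c1.
  have -> : (1 - z * y k) * (1 + c2) =
    (1 - z * y k) * (1 + c1) + (1 - z * y k) * i3 * (y k * z * (1 + c1)).
    by rewrite /c2; ring.
  by rewrite e3; ring.
rewrite /=.
have -> : (d - g * (z * u k)) * (1 - z * y k) = d * p1 * (1 - z * y k).
  by rewrite eg ep1; ring.
have [d' d'E] : exists d', d' = d * p1 * (1 - z * y k) by eexists.
rewrite -d'E.
have d'i : d' * (di * i1 * i3) = 1.
  have -> : d' * (di * i1 * i3) = (d * di) * (p1 * i1) * ((1 - z * y k) * i3).
    by rewrite d'E; ring.
  by rewrite ed e1' e3 !mulr1.
have eg' : g * (1 - z * u k) = d' * (1 + c2).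
  have -> : d' * (1 + c2) = d * (p1 * ((1 - z * y k) * (1 + c2))).
    by rewrite d'E; ring.
  by rewrite c2E c1E eg; ring.
have [? H] := IH _ _ _ _ eg' d'i; split=> //; rewrite !big_ord_recr /=.
move: H; move: (\prod_(j < k) (1 - z * r j)) (\prod_(j < k) ((1 - z * u j) * _)).
move: (pivots k _ _) => F P P' H.
rewrite [(k.+1 * 3)%N]mulSn addnC.
move: s1 s2 s3 H; move: (bsum (k * 3 + 3) c) (bsum (k * 3 + 2) c1) (bsum (k * 3 + 1) c1).
move: (bsum (k * 3) c2) => b3 b0 b1 b2 s1 s2 s3 H.
have {}s3 : b2 = b3.
  by rewrite -[b2]mul1r -[b3]mul1r -e3 mulrAC s3 mulrAC.
have -> : F * (P * (1 - z * r k)) * b0 = i1 * F * P * ((1 - z * r k) * (p1 * b0)).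
  by rewrite -[LHS]mul1r -e1'; ring.
rewrite s1 [(1 - z * r k) * _]mulrCA s2 s3.
have -> : i1 * F * P * ((1 - z * u k) * b3) = i1 * (1 - z * u k) * (F * P * b3) by ring.
rewrite H d'E.
have -> : i1 * (1 - z * u k) * (d * p1 * (1 - z * y k) * P') =
  (p1 * i1) * (d * (P' * ((1 - z * u k) * (1 - z * y k)))) by ring.
by rewrite e1' mul1r.
Qed.

(** The invariant is that [(1 - t) * (d - g * (z * u k))] has the form [P - t * Q]. Because
    [y j.+1 = t * u j], one more round multiplies [P] by [1 - z * u j] and [Q] by
    [1 - t * (z * u j)]. *)
Lemma pivots_closed (t : R) k d g P Q :
  y 0%N = 0 -> (forall j, y j.+1 = t * u j) ->
  g * (1 - z * u k) = P -> (1 - t) * (d - g * (z * u k)) = P - t * Q ->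
  (1 - t) * pivots k.+1 d g =
     P * \prod_(j < k) (1 - z * u j) - t * Q * \prod_(j < k) (1 - t * (z * u j)).
Proof.
move=> y0 yS; elim: k d g P Q => [|k IH] d g P Q eg ed.
  by rewrite !big_ord0 !mulr1 /= y0 mulr0 subr0 mulr1.
set d' := (d - g * (z * u k.+1)) * (1 - z * y k.+1).
rewrite [pivots _ _ _]/(pivots k.+1 d' (g * (1 - z * u k.+1))).
rewrite (IH _ _ (P * (1 - z * u k)) (Q * (1 - t * (z * u k)))).
- by rewrite !big_ord_recr /=; ring.
- by rewrite eg.
rewrite eg; have -> : (1 - t) * (d' - P * (z * u k)) =
    (1 - t) * (d - g * (z * u k.+1)) * (1 - z * y k.+1) - (1 - t) * (P * (z * u k)).
  by rewrite /d'; ring.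
by rewrite ed yS; ring.
Qed.

(** The generating function as a quotient, together with the value of its denominator [d0]. The
    condition [u N = 0] cuts the products over [u] and over [y] to the same length. *)
Theorem bsum_closed (t : R) N :
  y 0%N = 0 -> (forall j, y j.+1 = t * u j) -> u N = 0 ->
  let d0 := pivots N.+1 1 1 in
  [/\ exists i, d0 * i = 1,
  d0 * \prod_(j < N.+1) (1 - z * r j) * bsum (N.+1 * 3) 0 =
     \prod_(j < N) (1 - z * u j) * \prod_(j < N) (1 - t * (z * u j)) &
  (1 - t) * d0 = \prod_(j < N) (1 - z * u j) - t * \prod_(j < N) (1 - t * (z * u j))].
Proof.
move=> y0 yS uN /=; have [|| d0i H] := @pivots_bsum N.+1 0 1 1 1; rewrite ?addr0 ?mulr1 //.
split=> //.
  rewrite H mul1r big_split /= big_ord_recr /= uN mulr0 subr0 mulr1; congr (_ * _).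
  rewrite big_ord_recl y0 mulr0 subr0 mul1r; apply: eq_bigr => j _.
  by rewrite lift0 yS mulrCA.
rewrite (@pivots_closed t _ _ _ 1 1) // ?mul1r ?mulr1 // uN mulr0 subr0 ?mulr1 //.
Qed.

End Elimination.

(** * Sorted words and their block sizes *)

Fixpoint block_word (m : seq nat) : seq nat :=
  if m is k :: m' then nseq k (size m') ++ block_word m' else [::].

Lemma block_word_lt m : all (fun A => A < size m) (block_word m).
Proof.
elim: m => [|k m IH] //=; rewrite all_cat all_nseq ltnSn orbT /=.
by apply: sub_all IH => A /ltnW.
Qed.

Lemma block_word_sorted m : sorted geq (block_word m).
Proof.
elim: m => [|k m IH] //=; elim: k => [|k IHk] //=.
rewrite path_sortedE; last by move=> a b c /= h1 h2; apply: leq_trans h2 h1.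
rewrite IHk andbT all_cat all_nseq /= leqnn orbT /=.
by apply: sub_all (block_word_lt m) => A /ltnW.
Qed.

Lemma count_block_word m A :
  A < size m -> count_mem A (block_word m) = nth 0 (rev m) A.
Proof.
elim: m => [|k m IH] //=; rewrite ltnS leq_eqVlt count_cat count_nseq rev_cons nth_rcons size_rev.
have c0 : count_mem (size m) (block_word m) = 0.
  by apply/count_memPn/negP => /(allP (block_word_lt m)); rewrite ltnn.
case/predU1P => [-> | lA]; first by rewrite /= eqxx mul1n c0 addn0 ltnn.
by rewrite lA IH //= gtn_eqF.
Qed.

Lemma block_word_inj m m' : size m = size m' -> block_word m = block_word m' -> m = m'.
Proof.
move=> es e; apply: (can_inj revK); apply: (@eq_from_nth _ 0); rewrite !size_rev // => A lA.
by rewrite -count_block_word // e count_block_word // -es.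
Qed.

Lemma block_wordP L s : sorted geq s -> all (fun A => A < L) s ->
  block_word (rev (mkseq (fun A => count_mem A s) L)) = s.
Proof.
move=> ss sL; set m := rev _.
have sm : size m = L by rewrite size_rev size_mkseq.
apply: (@sorted_eq _ geq).
- by move=> a b c /= h1 h2; apply: leq_trans h2 h1.
- by move=> a b /=; rewrite -eqn_leq => /eqP.
- exact: block_word_sorted.
- done.
apply/allP => A _ /=; apply/eqP; case: (ltnP A L) => lA.
  by rewrite count_block_word ?sm // revK nth_mkseq.
have out t : all (fun A => A < L) t -> count_mem A t = 0.
  by move=> tL; apply/count_memPn/negP => /(allP tL); rewrite ltnNge lA.
by rewrite !out // -sm block_word_lt.
Qed.

(* An extreme position of its block: the first one for the letters of excedances, the last
   one for the others. *)
Definition special (s : seq nat) p :=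
  let A := nth 0 s p in
  if A %% 3 == 0 then A \notin take p s else A \notin drop p.+1 s.

(* Whether, for the sorted rearrangement [s] of a word, the sign of the letter [A] is
   compatible with its standing at position [p] of the word; see [admissible_sign]. *)
Definition admissible (s : seq nat) p A :=
  let B := nth 0 s p in
  match A %% 3 with
  | 0 => (B <= A) && ~~ ((B == A) && special s p)
  | 1 => B == A
  | _ => (A <= B) && ~~ ((B == A) && special s p)
  end.

(** * From coefficients of products to words *)

Section Words.
Local Open Scope ring_scope.

Lemma prod_special (S : comNzRingType) (L x : S) k s : (s < k.+1)%N ->
  \prod_(p < k.+1) (L - (p == s :> nat)%:R * x) = (L - x) * L ^+ k.
Proof.
move=> sk; rewrite (bigD1 (Ordinal sk)) //= eqxx mul1r; congr (_ * _).
rewrite (eq_bigr (fun => L)); last first.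
  by move=> i; rewrite -val_eqE /= => /negbTE ->; rewrite mul0r subr0.
by rewrite prodr_const cardC1 card_ord.
Qed.

(** Every nonempty block has exactly one special position, which takes the factor [L - x]. *)
Lemma gprodE (S : comNzRingType) (L x : nat -> S) m :
  gprod L x m =
  let s := block_word m in
  \prod_(p < size s) (L (nth 0%N s p) - (special s p)%:R * x (nth 0%N s p)).
Proof.
elim: m => [|k m IH] /=; first by rewrite big_ord0.
set s := block_word m; set N := size m.
have Ns : N \notin s.
  by apply/negP => /(allP (block_word_lt m)); rewrite ltnn.
rewrite size_cat size_nseq -(big_mkord xpredT (fun p => L (nth 0%N (nseq k N ++ s) p) -
  (special (nseq k N ++ s) p)%:R * x (nth 0%N (nseq k N ++ s) p))).
rewrite (big_cat_nat (n := k)) ?leq_addr //=; congr (_ * _); last first.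
  rewrite -[X in \prod_(X <= _ < _) _]add0n big_addn addKn IH big_mkord; apply: eq_bigr => p _.
  have np : nth 0%N (nseq k N ++ s) (p + k) = nth 0%N s p.
    by rewrite nth_cat size_nseq ltnNge leq_addl /= addnK.
  have pN : (nth 0%N s p == N) = false.
    by apply/eqP => e; move: Ns; rewrite -e mem_nth.
  rewrite np; congr (_ - (nat_of_bool _)%:R * _); rewrite /special np.
  rewrite take_cat drop_cat size_nseq -addSn !ltnNge !leq_addl /= !addnK.
  by rewrite mem_cat mem_nseq pN andbF.
case: k => [|k]; first by rewrite big_geq.
(* The special position of the top block. *)
pose s0 := if (N %% 3 == 0)%N then 0%N else k.
rewrite -/(gblock _ _ k.+1) /gblock -(@prod_special _ _ _ _ s0); last by rewrite /s0; case: ifP.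
rewrite big_mkord; apply: eq_bigr => p _.
have np : nth 0%N (nseq k.+1 N ++ s) p = N.
  by rewrite nth_cat size_nseq ltn_ord nth_nseq ltn_ord.
rewrite np; congr (_ - (nat_of_bool _)%:R * _); rewrite /special np.
rewrite take_cat drop_cat size_nseq ltn_ord.
rewrite take_nseq ?(ltnW (ltn_ord p)) // mem_nseq eqxx andbT /s0.
case: ifP => _; first by rewrite -eqn0Ngt.
have := ltn_ord p; rewrite ltnS leq_eqVlt => /predU1P[-> | lp].
  by rewrite ltnn subnn drop0 eqxx Ns.
rewrite ltnS lp ltn_eqF // mem_cat drop_nseq mem_nseq eqxx andbT; lia.
Qed.

Variable R : comNzRingType.

Lemma mext_prod_var N m s : size m = N -> all (fun A => A < N)%N s ->
  mext N m (\prod_(A <- s) mvar N A) = (perm_eq s (block_word m))%:R :> R.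
Proof.
elim: N m s => [|N IH] m s.
  by case: m => //; case: s => //= _ _; rewrite big_nil.
case: m => //= k m [sm] sN.
have perm_s : perm_eq s (nseq (count_mem N s) N ++ filter (predC1 N) s).
  rewrite -(permPl (permEl (perm_filterC (pred1 N) s))) perm_sym.
  apply: perm_cat; last exact: perm_refl.
  apply/seq.permP => P; rewrite count_nseq count_filter.
  elim: (s) => [|A t IHt] /=; first by rewrite muln0.
  by rewrite mulnDr IHt; case: eqVneq => [->|] /=; rewrite ?andbT ?andbF ?muln1 ?muln0.
have sN' : all (fun A => A < N)%N (filter (predC1 N) s).
  apply/allP => A; rewrite mem_filter /= => /andP[AN /(allP sN)].
  by rewrite ltnS leq_eqVlt (negbTE AN).
have -> : \prod_(A <- s) (if A == N then 'X else (mvar N A)%:P) =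
   'X^(count_mem N s) * (\prod_(A <- filter (predC1 N) s) mvar N A)%:P :> {poly mpol R N}.
  rewrite (perm_big _ perm_s) big_cat /= big_nseq; congr (_ * _).
    by rewrite eqxx; elim: (count_mem N s) => //= c ->; rewrite exprS.
  rewrite rmorph_prod big_seq [RHS]big_seq; apply: eq_bigr => A.
  by rewrite mem_filter /= => /andP[/negbTE ->].
rewrite mulrC coefCM coefXn.
have -> : (perm_eq s (nseq k (size m) ++ block_word m)) =
   (k == count_mem N s) && perm_eq (filter (predC1 N) s) (block_word m).
  rewrite (permPl perm_s) sm; case: eqVneq => [-> | kc] /=; first by rewrite perm_cat2l.
  apply/negP => /seq.permP/(_ (pred1 N)); rewrite !count_cat !count_nseq /= eqxx !mul1n.
  have -> : count_mem N (block_word m) = 0%N.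
    by apply/count_memPn/negP => /(allP (block_word_lt m)); rewrite sm ltnn.
  have -> : count_mem N (filter (predC1 N) s) = 0%N.
    by apply/count_memPn; rewrite mem_filter /= eqxx.
  by rewrite !addn0 => e; rewrite e eqxx in kc.
case: eqP => _ /=; last by rewrite mulr0 mext0.
by rewrite mulr1 IH.
Qed.

Definition word_seq n L (w : {ffun 'I_n -> 'I_L}) : seq nat :=
  [seq nat_of_ord (w p) | p <- enum 'I_n].

Lemma size_word_seq n L (w : {ffun 'I_n -> 'I_L}) : size (word_seq w) = n.
Proof. by rewrite size_map size_enum_ord. Qed.

Lemma nth_word_seq n L (w : {ffun 'I_n -> 'I_L}) (p : 'I_n) : nth 0%N (word_seq w) p = w p.
Proof. by rewrite (nth_map p) ?size_enum_ord // nth_ord_enum. Qed.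

Lemma word_seq_lt n L (w : {ffun 'I_n -> 'I_L}) : all (fun A => A < L)%N (word_seq w).
Proof. by apply/allP => A /mapP[p _ ->]. Qed.

(** Expanding the product chooses a letter at every position; the extracted monomial keeps the
    rearrangements of the sorted word. *)
Lemma mext_prod_lform n N m (c : 'I_n -> nat -> R) : size m = N ->
  mext N m (\prod_p lform N (c p)) =
  \sum_(w : {ffun 'I_n -> 'I_N} | perm_eq (word_seq w) (block_word m)) \prod_p c p (w p).
Proof.
move=> sm; rewrite bigA_distr_bigA mext_sum [RHS]big_mkcond; apply: eq_bigr => w _.
rewrite big_split /= -(rmorph_prod (mcst N)) mextZ.
have -> : \prod_(p < n) mvar N (w p) = \prod_(A <- word_seq w) mvar N A :> mpol R N.
  by rewrite big_map big_enum.
by rewrite mext_prod_var ?word_seq_lt //; case: perm_eq; rewrite ?mulr1 ?mulr0.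
Qed.

End Words.

(** * The eliminated sum as a sum over admissible words *)

Section WordSum.
Local Open Scope ring_scope.
Variables (R : comNzRingType) (K : nat) (z : R) (y r u : nat -> R).
Hypothesis zK : z ^+ K = 0.

Let wt := letter_wt y r u.

Definition word_sum L n (s : seq nat) : R :=
  \sum_(w : {ffun 'I_n -> 'I_L} | perm_eq (word_seq w) s)
     \prod_(p < n) ((admissible s p (w p))%:R * (z * wt (w p))).

Lemma word_sum0 L n s : (K <= n)%N -> word_sum L n s = 0.
Proof.
move=> Kn; apply: big1 => w _.
under eq_bigr do rewrite mulrCA.
have zn : z ^+ n = 0 by rewrite -(subnKC Kn) exprD zK mul0r.
by rewrite big_split /= prodr_const card_ord zn mul0r.
Qed.

Lemma bsum_word_sum L :
  bsum K z y r u L 0 =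
  \sum_(m <- mlists K.+1 L) word_sum L (size (block_word m)) (block_word m).
Proof.
rewrite /bsum /msum big_seq [RHS]big_seq; apply: eq_bigr => m.
rewrite mem_mlists => /andP[/eqP sm _]; rewrite gprodE /=.
set s := block_word m; rewrite /word_sum.
rewrite -(mext_prod_lform (fun (p : 'I_(size s)) A => (admissible s p A)%:R * (z * wt A)) sm).
congr mext.
apply: eq_bigr => p _; set B := nth _ _ _.
have lB : (B < L)%N by rewrite -sm (allP (block_word_lt m)) // mem_nth.
(* Once the barred term is a linear form too, the factor at [p] becomes a single form whose
   coefficients are the weights of the admissible letters. *)
have -> : mcst L (ends z y u B) * mvar L B = lform L (fun A => (A == B)%:R * ends z y u B).
  rewrite /lform (bigD1 (Ordinal lB)) //= eqxx mul1r big1 ?addr0 // => A.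
  by rewrite -val_eqE /= => /negbTE ->; rewrite mul0r rmorph0 mul0r.
have -> : (special s p)%:R = mcst L (special s p)%:R :> mpol R L by rewrite rmorph_nat.
rewrite -lformZ -mulN1r -(rmorphN1 (mcst L)) -lformZ -lformD; apply: eq_lform => A lA.
rewrite /bmat /ends /wt /letter_wt /admissible -/B.
case: (eqVneq A B) => [-> | _].
  rewrite leqnn; case: (B %% 3)%N => [|[|n]] /=; case: (special s p) => /=; ring.
by case: (A %% 3)%N => [|[|n]] /=; rewrite ?andbT; ring.
Qed.

End WordSum.

(** * Standardization of words *)

Section Standardization.
Variables (n L : nat).
Implicit Types (b w : {ffun 'I_n -> 'I_L}) (s : {perm 'I_n}).

Definition fiber_incr b s :=
  [forall i : 'I_n, forall j : 'I_n, (i < j) && (b i == b j) ==> (s i < s j)].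

Lemma fiber_incrP b s :
  reflect (forall i j : 'I_n, i < j -> b i = b j -> s i < s j) (fiber_incr b s).
Proof.
apply: (iffP forallP) => [H i j ij e | H i].
  by move/forallP/(_ j): (H i); rewrite ij e eqxx.
by apply/forallP => j; apply/implyP => /andP[ij /eqP]; apply: H.
Qed.

Definition word_of b s : {ffun 'I_n -> 'I_L} := [ffun p => b ((s^-1)%g p)].

Lemma word_ofE b s i : word_of b s (s i) = b i.
Proof. by rewrite ffunE permK. Qed.

Lemma perm_word_of b s : perm_eq (word_seq (word_of b s)) (word_seq b).
Proof.
apply/seq.permP => P; rewrite [LHS]count_map [RHS]count_map -!sum1_count !big_enum_cond /=.
rewrite (reindex_inj (@perm_inj _ s)) /=.
by apply: eq_bigl => i; rewrite word_ofE.
Qed.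

(** By strong induction, [s i] is forced to be the first position of the letter [b i] not taken by a
    smaller index. *)
Lemma word_of_inj b s s' :
  fiber_incr b s -> fiber_incr b s' -> word_of b s = word_of b s' -> s = s'.
Proof.
move=> hs hs' e; apply/permP => i.
have [k] := ubnP (nat_of_ord i); elim: k i => // k IH i; rewrite ltnS => ik.
have step (t t' : {perm 'I_n}) : fiber_incr b t' -> word_of b t = word_of b t' ->
    (forall j : 'I_n, j < i -> t j = t' j) -> t' i <= t i.
  move=> /fiber_incrP ht' ett' tj; rewrite leqNgt; apply/negP => lt.
  have [j ej] : exists j, t' j = t i by exists (t'^-1 (t i))%g; rewrite permKV.
  have bij : b i = b j by rewrite -(word_ofE b t i) -(word_ofE b t' j) ett' ej.
  case: (ltngtP i j) => [ij | ji | /val_inj ij].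
  - by have := ht' _ _ ij bij; rewrite ej ltnNge (ltnW lt).
  - by have eij := perm_inj (etrans (tj _ ji) ej); rewrite eij ltnn in ji.
  - by move: lt; rewrite ij ej -ij ltnn.
have low (j : 'I_n) : j < i -> s j = s' j by move=> ji; apply: IH; apply: leq_trans ji ik.
apply/val_inj/eqP; rewrite eqn_leq (step s' s) ?(step s s') // => j /low //.
Qed.

(* Among the permutations yielding a given word, the one maximising [\sum_i i * s i] is
   increasing on fibers. *)
Lemma word_of_surj b w : perm_eq (word_seq w) (word_seq b) ->
  exists2 s, fiber_incr b s & word_of b s = w.
Proof.
move=> pwb; have /tuple_permP[s0 es0] :
    perm_eq (word_seq w) (map_tuple (fun i => nat_of_ord (b i)) (ord_tuple n)) by [].
have ws0 : word_of b s0^-1 == w.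
  apply/eqP/ffunP => p; apply/val_inj; rewrite ffunE invgK.
  have := congr1 (fun t => nth 0 t p) es0; rewrite nth_word_seq /= => ->.
  by rewrite nth_mktuple tnth_map tnth_ord_tuple.
case: (@arg_maxnP _ _ (fun s => word_of b s == w) (fun s => \sum_(i < n) i * s i) ws0).
move=> s /eqP ws smax; exists s => //.
apply/fiber_incrP => i j ij bij; rewrite ltnNge; apply/negP; rewrite leq_eqVlt.
case/predU1P => [/val_inj/perm_inj e|sij]; first by move: ij; rewrite e ltnn.
(* Exchanging an inversion inside a fiber keeps the word and increases the sum. *)
have /smax : word_of b (tperm i j * s)%g == w.
  rewrite -ws; apply/eqP/ffunP => p; rewrite !ffunE invMg permM tpermV.
  by case: tpermP => [->|->|].
have ji : j != i by rewrite -val_eqE /= gtn_eqF.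
rewrite /= [X in X <= _](bigD1 i) // [X in _ <= X](bigD1 i) //=.
rewrite [X in _ + X <= _](bigD1 j) // [X in _ <= _ + X](bigD1 j) //=.
rewrite !permM tpermL tpermR [X in _ + (_ + X) <= _](eq_bigr (fun k : 'I_n => k * s k)); last first.
  by move=> k /andP[ki kj]; rewrite permM tpermD // eq_sym.
rewrite !addnA leq_add2r; nia.
Qed.

Lemma mem_take_word b p A :
  reflect (exists2 i : 'I_n, i < p & b i = A :> nat) (A \in take p (word_seq b)).
Proof.
have sz := size_word_seq b.
apply: (iffP (nthP 0)) => [[k]|[i ip <-]].
  rewrite size_take_min leq_min sz => /andP[kp kn].
  by rewrite nth_take // => <-; exists (Ordinal kn) => //; rewrite -nth_word_seq.
exists i; last by rewrite nth_take // nth_word_seq.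
by rewrite size_take_min leq_min ip sz ltn_ord.
Qed.

Lemma mem_drop_word b p A :
  reflect (exists2 i : 'I_n, p <= i & b i = A :> nat) (A \in drop p (word_seq b)).
Proof.
have sz := size_word_seq b.
apply: (iffP (nthP 0)) => [[k]|[i ip <-]].
  rewrite size_drop sz ltn_subRL => kn.
  rewrite nth_drop => <-; exists (Ordinal kn); first exact: leq_addr.
  by rewrite -nth_word_seq.
exists (i - p); last by rewrite nth_drop subnKC // nth_word_seq.
by rewrite size_drop sz ltn_sub2r // (leq_ltn_trans ip).
Qed.

Lemma sorted_word b (i j : 'I_n) : sorted geq (word_seq b) -> i <= j -> b j <= b i.
Proof.
have geq_trans : transitive geq by move=> x y t /= h1 h2; apply: leq_trans h2 h1.
move=> sb ij; rewrite -!nth_word_seq.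
by apply: (sorted_leq_nth geq_trans leqnn 0 sb); rewrite ?inE ?size_word_seq.
Qed.

Definition sign_ok b s :=
  [forall i : 'I_n, match b i %% 3 with 0 => i < s i | 1 => s i == i | _ => s i < i end].

(** As [b] decreases weakly, distinct letters [b (s i)] and [b i] compare oppositely to the
    positions [s i] and [i]. Ties inside a fiber are decided by the special position and the
    monotonicity of [s] on the fiber. *)
Lemma admissible_sign b s : sorted geq (word_seq b) -> fiber_incr b s ->
  [forall p : 'I_n, admissible (word_seq b) p (word_of b s p)] = sign_ok b s.
Proof.
move=> sb /fiber_incrP hs.
have mono (i j : 'I_n) : i <= j -> b j <= b i by apply: sorted_word.
have mid (i j k : 'I_n) : i <= j -> j <= k -> b i = b k -> b j = b i.
  move=> ij jk e; apply/val_inj/eqP; rewrite eqn_leq mono //= e mono //.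
have up (P : 'I_n -> Prop) :
    (forall i : 'I_n, (forall j : 'I_n, j < i -> P j) -> P i) -> forall i, P i.
  move=> H i; have [k] := ubnP (nat_of_ord i); elim: k i => // k IH i; rewrite ltnS => ik.
  by apply: H => j ji; apply: IH; apply: leq_trans ji ik.
have down (P : 'I_n -> Prop) :
    (forall i : 'I_n, (forall j : 'I_n, i < j -> P j) -> P i) -> forall i, P i.
  move=> H i; have [k] := ubnP (n - i); elim: k i => // k IH i; rewrite ltnS => ik.
  apply: H => j ji; apply: IH; apply: leq_trans ik; apply: ltn_sub2l => //.
have -> : [forall p : 'I_n, admissible (word_seq b) p (word_of b s p)] =
  [forall i : 'I_n, admissible (word_seq b) (s i) (b i)].
  apply/forallP/forallP => H i; first by move: (H (s i)); rewrite word_ofE.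
  by move: (H ((s^-1)%g i)); rewrite ffunE permKV.
apply/forallP/forallP => H; last first.
  move=> i; move: (H i); rewrite /admissible /special nth_word_seq.
  case e3 : (b i %% 3) => [|[|k]].
  - move=> isi; rewrite mono ?(ltnW isi) //=; apply/negP => /andP[/eqP e].
    rewrite e e3 /= => /negP; apply; apply/mem_take_word.
    by exists i.
  - by move=> /eqP ->.
  move=> sii; rewrite mono ?(ltnW sii) //=; apply/negP => /andP[/eqP e].
  rewrite e e3 /= => /negP; apply; apply/mem_drop_word.
  by exists i.
have {}H i := H i.
suff [H0 [H1 H2]] : (forall i : 'I_n, b i %% 3 = 0 -> i < s i) /\
   (forall i : 'I_n, b i %% 3 = 1 -> s i == i) /\ (forall i : 'I_n, 1 < b i %% 3 -> s i < i).
  move=> i; case e3 : (b i %% 3) => [|[|k]]; [exact: H0|exact: H1|].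
  by apply: H2; rewrite e3.
have adm i : admissible (word_seq b) (s i) (b i) := H i.
split; [|split].
- apply: up => i IH e3; have := adm i; rewrite /admissible /special nth_word_seq e3.
  case/andP=> le; rewrite ltnNge; apply: contra => si.
  have e : b (s i) = b i by apply/val_inj/eqP; rewrite eqn_leq le mono.
  rewrite e eqxx e3 /=; apply/mem_take_word => -[i' i's ei'].
  (* The predecessor of [s i] lies in the same fiber and is an excedance by induction, so its image
     is at least [s i], against monotonicity on the fiber. *)
  have pos : (s i).-1 < n by have := ltn_ord (s i); lia.
  pose j : 'I_n := Ordinal pos.
  have ji : j < i by rewrite /= ; lia.
  have ej : b j = b i.
    rewrite -(val_inj ei'); apply: (mid _ _ i); [rewrite /=; lia|exact: ltnW|exact: val_inj].
  by have := IH j ji; rewrite ej => /(_ e3); have := hs _ _ ji ej; rewrite /=; lia.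
(* Here [s] maps the fiber to itself increasingly, hence is the identity on it. *)
- have fib i : b i %% 3 = 1 -> b (s i) = b i.
    move=> e3; have := adm i; rewrite /admissible nth_word_seq e3 => /eqP.
    exact: val_inj.
  have le1 : forall i : 'I_n, b i %% 3 = 1 -> i <= s i.
    apply: up => i IH e3; rewrite leqNgt; apply/negP => lt.
    by have := hs _ _ lt (fib _ e3); have := IH _ lt; rewrite fib // => /(_ e3); lia.
  have le2 : forall i : 'I_n, b i %% 3 = 1 -> s i <= i.
    apply: down => i IH e3; rewrite leqNgt; apply/negP => lt.
    by have := hs _ _ lt (esym (fib _ e3)); have := IH _ lt; rewrite fib // => /(_ e3); lia.
  by move=> i e3; rewrite -val_eqE eqn_leq le1 // le2.
apply: down => i IH e3; have := adm i; rewrite /admissible /special nth_word_seq.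
case e3' : (b i %% 3) e3 => [|[|k]] // _ /andP[le]; rewrite ltnNge; apply: contra => si.
have e : b (s i) = b i by apply/val_inj/eqP; rewrite eqn_leq le mono.
rewrite e eqxx e3' /=; apply/mem_drop_word => -[i' i's ei'].
have pos : (s i).+1 < n by have := ltn_ord i'; lia.
pose j : 'I_n := Ordinal pos.
have ji : i < j by rewrite /=; lia.
have ej : b i = b j.
  symmetry; apply: (mid _ _ i'); [exact: ltnW|rewrite /=; lia|exact: val_inj].
by have := IH j ji; rewrite -ej e3' => /(_ isT); have := hs _ _ ji ej; rewrite /=; lia.
Qed.

End Standardization.

(** * From words to pairs of a permutation and a sorted sequence *)

Section PermSum.
Local Open Scope ring_scope.
Variables (R : comNzRingType) (K : nat) (z : R) (y r u : nat -> R).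
Hypothesis zK : z ^+ K = 0.

Lemma word_sum_perm n L (b : {ffun 'I_n -> 'I_L}) : sorted geq (word_seq b) ->
  word_sum z y r u L n (word_seq b) =
  \sum_(s : {perm 'I_n} | fiber_incr b s && sign_ok b s) \prod_i (z * letter_wt y r u (b i)).
Proof.
move=> sb; rewrite /word_sum.
(* The inverse of [word_of b]; the default value is met only outside the rearrangements of [b]. *)
pose inv w := odflt 1%g [pick s | fiber_incr b s && (word_of b s == w)].
have invK w : perm_eq (word_seq w) (word_seq b) -> fiber_incr b (inv w) && (word_of b (inv w) == w).
  move=> /word_of_surj[s hs ws]; rewrite /inv; case: pickP => //= H.
  by have := H s; rewrite hs ws eqxx.
rewrite (reindex_onto (word_of b) inv); last by move=> w /invK/andP[_ /eqP].
rewrite (eq_bigl (fiber_incr b)); last first.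
  move=> s; rewrite perm_word_of /=; apply/eqP/idP => [<-|hs].
    by have /invK/andP[] := perm_word_of b s.
  have /andP[hi /eqP ei] := invK _ (perm_word_of b s).
  exact: word_of_inj hi hs ei.
rewrite big_mkcondr; apply: eq_bigr => s hs; rewrite -admissible_sign // big_split /=.
rewrite [X in _ * X](reindex_inj (@perm_inj _ s)) /=.
under [X in _ * X]eq_bigr do rewrite word_ofE.
case: forallP => [H | H]; first by rewrite big1 ?mul1r // => p _; rewrite H.
suff -> : \prod_(p < n) (admissible (word_seq b) p (word_of b s p))%:R = 0 :> R by rewrite mul0r.
have /existsP[p /negbTE Hp] : [exists p : 'I_n, ~~ admissible (word_seq b) p (word_of b s p)].
  by rewrite -negb_forall; apply/negP => /forallP.
by rewrite (bigD1 p) //= Hp mul0r.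
Qed.

(** A sorted word amounts to its letter multiplicities, and those of a word shorter than [K] respect
    the bound in [mlists K.+1 L]. *)
Lemma sum_mlists L (f : seq nat -> R) :
  \sum_(m <- mlists K.+1 L | (size (block_word m) < K)%N) f (block_word m) =
  \sum_(n < K) \sum_(b : {ffun 'I_n -> 'I_L} | sorted geq (word_seq b)) f (word_seq b).
Proof.
transitivity (\sum_(n < K) \sum_(m <- mlists K.+1 L | size (block_word m) == n) f (block_word m)).
  rewrite big_mkcond /=; under [RHS]eq_bigr do rewrite big_mkcond /=.
  rewrite exchange_big /=; apply: eq_bigr => m _; case: ifP => lt.
    rewrite (bigD1 (Ordinal lt)) //= eqxx big1 ?addr0 // => i.
    by rewrite -val_eqE /= eq_sym => /negbTE ->.
  by rewrite big1 // => i _; case: eqP => // e; rewrite e ltn_ord in lt.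
apply: eq_bigr => n _; rewrite -big_filter -[LHS](big_map block_word xpredT f).
rewrite -[RHS]big_filter.
rewrite -[RHS](big_map (@word_seq n L) xpredT f).
apply: perm_big; apply: uniq_perm.
- rewrite map_inj_in_uniq ?filter_uniq ?uniq_mlists // => m m'.
  rewrite !mem_filter !mem_mlists => /andP[_ /andP[/eqP sm _]] /andP[_ /andP[/eqP sm' _]].
  by apply: block_word_inj; rewrite sm sm'.
- rewrite map_inj_uniq ?filter_uniq ?index_enum_uniq // => b b' e.
  by apply/ffunP => p; apply/val_inj; rewrite /= -2!nth_word_seq e.
move=> s; apply/mapP/mapP => -[].
  move=> m; rewrite mem_filter mem_mlists => /andP[/eqP sn /andP[/eqP sm _]] es.
  have lt (p : 'I_n) : (nth 0%N s p < L)%N.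
    by rewrite -sm (allP (block_word_lt m)) // es mem_nth // sn.
  have e : word_seq [ffun p => Ordinal (lt p)] = s.
    apply: (@eq_from_nth _ 0%N); rewrite size_word_seq; first by rewrite es.
    by move=> i li; rewrite -[i]/(nat_of_ord (Ordinal li)) nth_word_seq ffunE.
  exists [ffun p => Ordinal (lt p)] => //.
  by rewrite mem_filter mem_index_enum e es block_word_sorted.
move=> b; rewrite mem_filter => /andP[sb _] ->.
exists (rev (mkseq (fun A => count_mem A (word_seq b)) L)); last first.
  by rewrite block_wordP // word_seq_lt.
rewrite mem_filter mem_mlists block_wordP ?word_seq_lt //.
rewrite size_word_seq size_rev size_mkseq !eqxx /= all_rev.
apply/allP => A /mapP[B _ ->]; rewrite ltnS (leq_trans (count_size _ _)) //.
by rewrite size_word_seq ltnW.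
Qed.

Theorem bsum_perm L :
  bsum K z y r u L 0 =
  \sum_(n < K) \sum_(b : {ffun 'I_n -> 'I_L} | sorted geq (word_seq b))
    \sum_(s : {perm 'I_n} | fiber_incr b s && sign_ok b s)
      \prod_i (z * letter_wt y r u (b i)).
Proof.
rewrite bsum_word_sum // (bigID (fun m => size (block_word m) < K)%N) /=.
rewrite [X in _ + X]big1 ?addr0; last by move=> m; rewrite -leqNgt => /(word_sum0 _ _ _ zK) ->.
rewrite (sum_mlists L (fun s => word_sum z y r u L (size s) s)).
apply: eq_bigr => n _; apply: eq_bigr => b sb.
by rewrite size_word_seq word_sum_perm.
Qed.

End PermSum.

(** The fibers of a sorted sequence are intervals, so both conditions can be tested on adjacent
    positions. *)
Lemma adjacent_fiber_incrP n L (b : {ffun 'I_n -> 'I_L}) (s : {perm 'I_n}) :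
  reflect (forall i j : 'I_n, j = i.+1 :> nat -> b j < b i \/ b j = b i /\ s i < s j)
          (sorted geq (word_seq b) && fiber_incr b s).
Proof.
apply: (iffP andP) => [[sb /fiber_incrP hs] i j ij | H].
  have := sorted_word sb (_ : i <= j); rewrite ij leqnSn => /(_ isT).
  rewrite leq_eqVlt => /predU1P[/val_inj e|]; [right|by left].
  by split=> //; apply: hs; rewrite ?ij.
have sb : sorted geq (word_seq b).
  apply/(sortedP 0) => i; rewrite size_word_seq => li.
  rewrite -[i.+1]/(nat_of_ord (Ordinal li)) -[i]/(nat_of_ord (Ordinal (ltnW li))) !nth_word_seq /=.
  by case: (H (Ordinal (ltnW li)) (Ordinal li) erefl) => [/ltnW | [-> _]].
split=> //; apply/fiber_incrP => i j.
have [k] := ubnP (nat_of_ord j); elim: k j => // k IH j; rewrite ltnS => jk ij bij.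
have pj : j.-1 < n by have := ltn_ord j; lia.
have jE : j = (Ordinal pj).+1 :> nat by rewrite /=; lia.
have ij' : i <= Ordinal pj by rewrite /=; lia.
have b1 := sorted_word sb ij'.
have b2 : b j <= b (Ordinal pj) by apply: sorted_word sb _; rewrite /=; lia.
have e' : b i = b (Ordinal pj) by apply/val_inj/eqP; rewrite eqn_leq b1 bij b2.
case: (H _ _ jE) => [|[_ lt]]; first by rewrite -e' bij ltnn.
move: ij'; rewrite leq_eqVlt => /predU1P[/val_inj -> //|lt'].
apply: ltn_trans lt; apply: IH => //=; lia.
Qed.

(** * Colored permutations and compatible sequences *)

Definition sgn3 a i := if a < i then 2 else if a == i then 1 else 0.

Lemma sign_okP n L (b : {ffun 'I_n -> 'I_L}) (s : {perm 'I_n}) :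
  reflect (forall i : 'I_n, b i %% 3 = sgn3 (s i) i) (sign_ok b s).
Proof.
apply: (iffP forallP) => H i; have := H i; rewrite /sgn3 -?val_eqE /=.
  by have := ltn_pmod (b i) (isT : 0 < 3); case: (b i %% 3) => [|[|[|//]]] _; case: ltngtP.
by move=> ->; case: ltngtP.
Qed.

(** When [s = s'] and [c = c'], the inequality [a < a'] amounts to [a - i <= a' - i.+1] over the
    integers, so the sign digit agrees with the descent condition. *)
Lemma sgn3_step l a a' i s s' c c' : c < l -> c' < l -> a <> a' ->
  let B := (s * l + c) * 3 + sgn3 a i in
  let B' := (s' * l + c') * 3 + sgn3 a' i.+1 in
  (B' < B \/ B' = B /\ a < a') <->
  s' + clt (a'.+1, c') (a.+1, c) <= s.
Proof.
move=> cl cl' aa' B B'; rewrite /B /B' /clt /= ltnS.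
have s3 x y : sgn3 x y < 3 by rewrite /sgn3; case: ifP => // _; case: ifP.
have h1 := s3 a i; have h2 := s3 a' i.+1.
have mono x x' : x < x' -> x * l + l <= x' * l.
  by move=> lt; rewrite addnC -mulSn leq_mul2r lt orbT.
case: (ltngtP s s') => [lt | lt | <-].
- by have := mono _ _ lt; split; lia.
- by have := mono _ _ lt; case: (_ || _); split; lia.
rewrite eq_sym; case: (ltngtP c c') => [lt | lt | <-] /=; try by split; lia.
rewrite /sgn3 in h1 h2 *.
by case: (ltngtP a i); case: (ltngtP a' i.+1); case: (ltngtP a' a) => //=; split; lia.
Qed.

Section ColoredPerm.
Variables n l : nat.
Implicit Types p : cperm n l.

Definition exc_at p (i : 'I_n) : bool := (colr p i == 0) && (absv p i > i.+1).

(** The sequences that MacMahon's Verfahren attaches to [p], with values below [W]. *)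
Definition compat W p (s : {ffun 'I_n -> 'I_W}) :=
  [forall i : 'I_n, forall j : 'I_n, (j == i.+1 :> nat) ==> (s j + cdes p i <= s i)].

Lemma compatP W p (s : {ffun 'I_n -> 'I_W}) :
  reflect (forall i j : 'I_n, j = i.+1 :> nat -> s j + cdes p i <= s i) (compat p s).
Proof.
apply: (iffP forallP) => [H i j e | H i].
  by move/forallP/(_ j): (H i); rewrite e eqxx.
by apply/forallP => j; apply/implyP => /eqP; apply: H.
Qed.

Lemma cdesE p (i j : 'I_n) : j = i.+1 :> nat ->
  cdes p i = clt (absv p j, colr p j) (absv p i, colr p i).
Proof.
move=> e; rewrite /cdes -e; case: insubP => [k _ /val_inj -> //|].
by rewrite ltn_ord.
Qed.

Lemma cdes_last p (i : 'I_n) : n <= i.+1 -> cdes p i = false.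
Proof. by move=> e; rewrite /cdes insubF // ltnNge e. Qed.

Local Open Scope ring_scope.

(* Together, a coloring and a compatible sequence [s] form the weakly decreasing sequence
   [s i * l + color i], and compatibility makes the permutation increase on its fibers. *)
Lemma colored_sum (R : comNzRingType) (F : nat -> R) W L : (0 < l)%N -> L = (W * l * 3)%N ->
  \sum_(b : {ffun 'I_n -> 'I_L} | sorted geq (word_seq b))
    \sum_(s : {perm 'I_n} | fiber_incr b s && sign_ok b s) \prod_i F (b i) =
  \sum_(p : cperm n l) \sum_(s : {ffun 'I_n -> 'I_W} | compat p s)
    \prod_i F ((s i * l + p.2 i) * 3 + sgn3 (p.1 i) i)%N.
Proof.
move=> l0 ->; rewrite (exchange_big_dep xpredT) //=.
transitivity (\sum_(g : {perm 'I_n}) \sum_(c : {ffun 'I_n -> 'I_l})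
  \sum_(s : {ffun 'I_n -> 'I_W} | compat ((g, c) : cperm n l) s)
    \prod_i F ((s i * l + c i) * 3 + sgn3 (g i) i)%N); last first.
  by rewrite pair_bigA; apply: eq_bigr => -[g c] _.
apply: eq_bigr => g _; rewrite pair_big_dep /=.
have sg_lt i : (sgn3 (g i) i < 3)%N by rewrite /sgn3; case: ifP => // _; case: ifP.
have lt1 (cs : {ffun 'I_n -> 'I_l} * {ffun 'I_n -> 'I_W}) i :
    ((cs.2 i * l + cs.1 i) * 3 + sgn3 (g i) i < W * l * 3)%N.
  have h1 := ltn_ord (cs.1 i); have h2 := ltn_ord (cs.2 i).
  have h3 : (cs.2 i * l + l <= W * l)%N by rewrite addnC -mulSn leq_mul2r h2 orbT.
  by have := sg_lt i; lia.
have lt2 (b : {ffun 'I_n -> 'I_(W * l * 3)}) i : (b i %/ 3 %/ l < W)%N.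
  by rewrite ltn_divLR // ltn_divLR.
have lt3 (b : {ffun 'I_n -> 'I_(W * l * 3)}) i : (b i %/ 3 %% l < l)%N by rewrite ltn_pmod.
pose h cs : {ffun 'I_n -> 'I_(W * l * 3)} := [ffun i => Ordinal (lt1 cs i)].
pose h' b : {ffun 'I_n -> 'I_l} * {ffun 'I_n -> 'I_W} :=
  ([ffun i => Ordinal (lt3 b i)], [ffun i => Ordinal (lt2 b i)]).
have hM cs i : (h cs i %% 3 = sgn3 (g i) i)%N by rewrite ffunE /= modnMDl modn_small.
have hD cs i : (h cs i %/ 3 = cs.2 i * l + cs.1 i)%N.
  by rewrite ffunE /= divnMDl // divn_small // addn0.
(* The inverse [h'] forgets the residue modulo 3, which [sign_ok] makes a function of [g]. *)
rewrite (reindex_onto h h'); last first.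
  move=> b /andP[_ /andP[_ /sign_okP sb]]; apply/ffunP => i; apply/val_inj.
  by rewrite ffunE /= !ffunE /= -divn_eq -sb -divn_eq.
apply: eq_big => [cs | cs _]; last by apply: eq_bigr => i _; rewrite ffunE.
rewrite andbA.
have -> : sign_ok (h cs) g by apply/sign_okP.
have -> : h' (h cs) == cs.
  case: cs => c s; apply/eqP; congr (_, _); apply/ffunP => i; apply/val_inj.
    by rewrite ffunE /= hD /= modnMDl modn_small.
  by rewrite ffunE /= hD /= divnMDl // divn_small // addn0.
rewrite !andbT; apply/adjacent_fiber_incrP/compatP => H i j ij.
  rewrite (cdesE _ ij); have := H i j ij.
  have -> : (h cs j = h cs i) <-> (h cs j = h cs i :> nat) by split => [->//|/val_inj].
  rewrite !ffunE /= ij; apply: (sgn3_step _ _ _ _ _ _).1; rewrite /colr ?ltn_ord //.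
  by move/val_inj/perm_inj => e; rewrite e in ij; lia.
have := H i j ij; rewrite (cdesE _ ij).
have -> : (h cs j = h cs i) <-> (h cs j = h cs i :> nat) by split => [->//|/val_inj].
rewrite !ffunE /= ij; apply: (sgn3_step _ _ _ _ _ _).2; rewrite /colr ?ltn_ord //.
by move/val_inj/perm_inj => e; rewrite e in ij; lia.
Qed.

End ColoredPerm.

(** * MacMahon's Verfahren *)

Section MacMahon.
Variables n l : nat.
Implicit Types p : cperm n l.

(** If [s i = 0], there is no descent from [i] on, so the colors stay zero and the values increase
    strictly; starting above [i], they would be too large at the last position. Thus the subtraction
    [s i - exc_at p i] is never truncated. *)
Lemma compat_exc W p (s : {ffun 'I_n -> 'I_W}) i :
  compat p s -> exc_at p i -> 0 < s i.
Proof.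
move=> /compatP cs /andP[/eqP c0]; rewrite /absv ltnS => lt; rewrite lt0n; apply/negP => /eqP s0.
have H k : forall j : 'I_n, j = i + k :> nat ->
    [/\ s j = 0 :> nat, colr p j = 0 & p.1 i + k <= p.1 j].
  elim: k => [|k IH] j ej.
    by have -> : j = i by [apply/val_inj; rewrite /= ej addn0]; rewrite addn0.
  have lk : i + k < n by have := ltn_ord j; rewrite ej; lia.
  have [sk ck ak] := IH (Ordinal lk) erefl.
  have jE : j = (Ordinal lk).+1 :> nat by rewrite /=; lia.
  have := cs _ _ jE; rewrite sk (cdesE _ jE) /clt ck /= /absv ltnS => le.
  have sj : s j = 0 :> nat by lia.
  have cj : colr p j = 0 by move: le; case: ltngtP => //=; lia.
  split=> //; move: le; rewrite cj /= sj add0n; case: ltnP => // le _.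
  have ne : p.1 (Ordinal lk) <> p.1 j :> nat.
    by move=> /val_inj/perm_inj e; rewrite -e /= in ej; lia.
  by rewrite addnS (leq_ltn_trans ak) // ltn_neqAle le andbT; apply/eqP.
have ln : i + (n.-1 - i) < n by have := ltn_ord i; lia.
have [_ _] := H _ (Ordinal ln) erefl.
by have := ltn_ord (p.1 (Ordinal ln)); have := ltn_ord i; lia.
Qed.

Variables (V W : nat) (p : cperm n l).
Hypothesis ltW : n * V.+1 < W.
Implicit Types d : {ffun 'I_n -> 'I_V.+1}.

Definition tail_sum d (k : nat) := \sum_(j < n | k <= j) (d j + cdes p j).

Lemma tail_sum_rec d (i : 'I_n) : tail_sum d i = d i + cdes p i + tail_sum d i.+1.
Proof.
rewrite /tail_sum (bigD1 i) //=; congr (_ + _); apply: eq_bigl => j.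
by rewrite ltn_neqAle -val_eqE eq_sym andbC.
Qed.

Lemma tail_sum_end d k : n <= k -> tail_sum d k = 0.
Proof. by move=> nk; rewrite /tail_sum big_pred0 // => j; apply/negbTE; have := ltn_ord j; lia. Qed.

Lemma tail_sum_lt d k : tail_sum d k < W.
Proof.
apply: leq_ltn_trans ltW.
rewrite /tail_sum big_mkcond /= -[n in n * _]card_ord -sum_nat_const leq_sum // => j _.
by case: ifP => // _; have := ltn_ord (d j); case: cdes; lia.
Qed.

(* The compatible sequence with [d i] in excess of the forced decrease at each [i]. *)
Definition of_gaps d : {ffun 'I_n -> 'I_W} :=
  [ffun i : 'I_n => Ordinal (tail_sum_lt d i)].

(** Past the last position the sequence continues with 0, so the last gap is the last value. *)
Definition next (s : {ffun 'I_n -> 'I_W}) (i : 'I_n) : nat :=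
  if insub i.+1 is Some j then s j else 0.

Definition gap (s : {ffun 'I_n -> 'I_W}) (i : 'I_n) := s i - next s i - cdes p i.

Definition gaps s : {ffun 'I_n -> 'I_V.+1} := [ffun i => inord (gap s i)].

Lemma next_of_gaps d i : next (of_gaps d) i = tail_sum d i.+1.
Proof.
rewrite /next; case: insubP => [j _ ej | ]; first by rewrite ffunE /= ej.
by rewrite -leqNgt => /tail_sum_end ->.
Qed.

Lemma gap_of_gaps d i : gap (of_gaps d) i = d i.
Proof. by rewrite /gap next_of_gaps ffunE /= tail_sum_rec; lia. Qed.

Lemma of_gapsK d : gaps (of_gaps d) = d.
Proof. by apply/ffunP => i; rewrite ffunE gap_of_gaps inord_val. Qed.

Lemma compat_of_gaps d : compat p (of_gaps d).
Proof. by apply/compatP => i j ij; rewrite !ffunE /= (tail_sum_rec d i) ij; lia. Qed.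

Lemma gapsK s : compat p s -> (forall i, gap s i <= V) -> of_gaps (gaps s) = s.
Proof.
move=> /compatP cs sV.
have nextE i : s i = gap s i + cdes p i + next s i :> nat.
  rewrite /gap /next; case: insubP => [j _ ej|]; first by have := cs _ _ ej; lia.
  by rewrite -leqNgt => /cdes_last ->; lia.
apply/ffunP => i; apply/val_inj; rewrite ffunE /=.
have [k] := ubnP (n - i); elim: k i => // k IH i; rewrite ltnS => ik.
rewrite tail_sum_rec nextE ffunE inordK ?ltnS //; congr (_ + _).
rewrite /next; case: insubP => [j _ ej|]; last by rewrite -leqNgt => /tail_sum_end.
by rewrite -ej; apply: IH; have := ltn_ord i; rewrite /= in ej; lia.
Qed.

Lemma cexcE : cexc p = \sum_i exc_at p i.
Proof. by rewrite /cexc -sum1dep_card big_mkcond. Qed.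

Lemma sum_tail_sum d : \sum_(i < n) tail_sum d i = cmaj p + \sum_(j < n) j.+1 * d j.
Proof.
rewrite /tail_sum (exchange_big_dep xpredT) //= /cmaj [X in _ = X + _]big_mkcond -big_split /=.
apply: eq_bigr => j _; rewrite (eq_bigl (fun i : 'I_n => i < j.+1)) //.
rewrite -(big_ord_widen _ (fun=> d j + cdes p j)) ?ltn_ord //.
by rewrite sum_nat_const card_ord; case: cdes; lia.
Qed.

Lemma exc_tail_sum d i : exc_at p i <= tail_sum d i.
Proof.
case e : exc_at => //; have := compat_exc (compat_of_gaps d) e.
by rewrite ffunE.
Qed.

(** The compatible sequence with zero gaps has sum [cmaj p] and is positive at every excedance. *)
Lemma cexc_le_cmaj : cexc p <= cmaj p.
Proof.
have := sum_tail_sum [ffun=> ord0].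
rewrite [X in _ + X]big1 => [|i _]; last by rewrite ffunE muln0.
by rewrite addn0 cexcE => <-; apply: leq_sum => i _; apply: exc_tail_sum.
Qed.

Local Open Scope ring_scope.

(** The gaps are free, and each unit of gap at [j] adds [j.+1] to the sum of the sequence, which is
    [cmaj p] at least. A gap above [V] yields a vanishing power of [q]. *)
Lemma macmahon (R : comNzRingType) (q : R) : q ^+ V = 0 ->
  \sum_(s : {ffun 'I_n -> 'I_W} | compat p s) \prod_i q ^+ (s i - exc_at p i) =
  q ^+ (cmaj p - cexc p) * \prod_(j < n) \sum_(d < V.+1) q ^+ (j.+1 * d).
Proof.
move=> qV; rewrite (bigID (fun s => [forall i, gap s i <= V]%N)) /=.
rewrite [X in _ + X]big1 ?addr0; last first.
  move=> s /andP[cs]; rewrite negb_forall => /existsP[i]; rewrite -ltnNge => lt.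
  have le : (V <= s i - exc_at p i)%N.
    by move: lt; rewrite /gap; case: exc_at; lia.
  by rewrite (bigD1 i) //= -(subnKC le) exprD qV !mul0r.
rewrite (reindex_onto of_gaps gaps); last first.
  by move=> s /andP[cs /forallP sV]; apply: gapsK.
rewrite bigA_distr_bigA /= mulr_sumr; apply: eq_big => [d | d _].
  rewrite compat_of_gaps of_gapsK eqxx andbT /=; apply/forallP => i.
  by rewrite gap_of_gaps -ltnS.
rewrite -[LHS]expr_sum -[X in _ * X]expr_sum -exprD; congr (_ ^+ _).
rewrite sumnB => [|i _]; last by rewrite ffunE exc_tail_sum.
rewrite -cexcE addnC addnBA ?cexc_le_cmaj // addnC -sum_tail_sum; congr (_ - _)%N.
by apply: eq_bigr => i _; rewrite ffunE.
Qed.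

End MacMahon.

(** * The truncated q-exponential *)

Section QExponential.
Local Open Scope ring_scope.
Variables (R : comNzRingType) (M K : nat) (q : R).
Hypothesis qM : q ^+ M = 0.

(* Since [q ^+ M = 0], this is the inverse of [\prod_(j < n) (1 - q ^+ j.+1)]. *)
Definition qfact_inv n : R := \prod_(j < n) \sum_(d < M.+1) q ^+ (j.+1 * d).

Lemma qfact_invS n : (1 - q ^+ n.+1) * qfact_inv n.+1 = qfact_inv n.
Proof.
rewrite /qfact_inv big_ord_recr /= mulrCA.
under [X in _ * (_ * X)]eq_bigr do rewrite exprM.
rewrite -[1 - _]opprB mulNr -subrX1 opprB -exprM mulSn exprD.
have -> : q ^+ M.+1 = 0 by rewrite exprS qM mulr0.
by rewrite mul0r subr0 mulr1.
Qed.

Definition qexp (x : R) : R := \sum_(n < K.+1) qfact_inv n * x ^+ n.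

Lemma qexp_shift x : x ^+ K = 0 -> (1 - x) * qexp x = qexp (q * x).
Proof.
move=> xK; rewrite mulrBl mul1r; apply/eqP; rewrite subr_eq addrC -subr_eq; apply/eqP.
rewrite /qexp -sumrB big_ord_recl !expr0 subrr add0r; under eq_bigr do rewrite lift0.
rewrite [in RHS]big_ord_recr /= xK mulr0 addr0 mulr_sumr; apply: eq_bigr => n _.
rewrite -(qfact_invS n) exprMn [x ^+ n.+1]exprS; ring.
Qed.

Lemma qexp0 : qexp 0 = 1.
Proof.
rewrite /qexp big_ord_recl big1 ?addr0 => [|i _]; last by rewrite expr0n mulr0.
by rewrite expr0 mulr1 /qfact_inv big_ord0.
Qed.

(** Euler's product: iterating [qexp_shift] leads to [qexp (q ^+ W * x)], which is [qexp 0 = 1]. *)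
Lemma qexp_prod W x : x ^+ K = 0 -> (M <= W)%N ->
  \prod_(s < W) (1 - x * q ^+ s) * qexp x = 1.
Proof.
move=> xK MW.
have H k : \prod_(s < k) (1 - x * q ^+ s) * qexp x = qexp (q ^+ k * x).
  elim: k => [|k IH]; first by rewrite big_ord0 expr0 !mul1r.
  have kK : (q ^+ k * x) ^+ K = 0 by rewrite exprMn xK mulr0.
  rewrite big_ord_recr /= mulrAC IH exprS -[q * _ * x]mulrA -(qexp_shift kK).
  by rewrite mulrC [x * _]mulrC.
by rewrite H -(subnKC MW) exprD qM !mul0r qexp0.
Qed.

End QExponential.

Lemma prod_div_mod (R : comNzRingType) l W (F : nat -> nat -> R) : 0 < l ->
  (\prod_(k < W * l) F (k %/ l)%N (k %% l)%N = \prod_(c < l) \prod_(s < W) F s c)%R.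
Proof.
move=> l0; rewrite exchange_big -(big_mkord xpredT (fun k => F (k %/ l) (k %% l))).
rewrite big_nat_mul big_mkord; apply: eq_bigr => s _.
rewrite mulSn addnC -{1}[s * l]add0n big_addn addKn big_mkord; apply: eq_bigr => c _.
by rewrite addnC divnMDl // divn_small // addn0 modnMDl modn_small.
Qed.

(** * The generating function of colored permutations *)

Section Generating.
Local Open Scope ring_scope.
Variables (R : comNzRingType) (K M l : nat) (z q t : R).
Hypotheses (zK : z ^+ K = 0) (qM : q ^+ M = 0) (l0 : (0 < l)%N).

(** Large enough for the gap sequences of every length below [K] and, when [K] is positive, for the
    weight [u] of the top value to vanish. *)
Let W := (K * M.+1).+2.
Let u k := q ^+ (k %/ l)%N * t ^+ (k %% l)%N.
(** At [k = s * l + c], the weight [t * u k.-1] is [q ^+ s * t ^+ c] if [c > 0], and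
    [q ^+ s.-1 * t ^+ l] if [c = 0 < s]. So one shift accounts both for [l * cexc p] in [cfexc p]
    and for subtracting [cexc p] from [cmaj p]. *)
Let y k := if k is k'.+1 then t * u k' else 0.
Let rho r k := if (l %| k)%N then r * u k else u k.

Definition stat_sum n (r : R) : R :=
  \sum_(p : cperm n l) t ^+ cfexc p * r ^+ cfix p * q ^+ (cmaj p - cexc p).

Definition gen_fun r : R :=
  \sum_(n < K) z ^+ n * (qfact_inv M q n * stat_sum n r).

Lemma letter_wtE r (s c a i : nat) : (c < l)%N ->
  ((c == 0) && (i < a) -> 0 < s)%N ->
  letter_wt y (rho r) u ((s * l + c) * 3 + sgn3 a i)%N =
  t ^+ (l * ((c == 0) && (i < a))%N + c) * r ^+ ((c == 0) && (a == i))%N *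
  q ^+ (s - ((c == 0) && (i < a))%N).
Proof.
move=> cl hs; have s3 : (sgn3 a i < 3)%N by rewrite /sgn3; case: ifP => // _; case: ifP.
rewrite /letter_wt modnMDl divnMDl // [(sgn3 a i %% 3)%N]modn_small // divn_small // addn0.
have uE s' c' : (c' < l)%N -> u (s' * l + c') = q ^+ s' * t ^+ c'.
  by move=> cl'; rewrite /u divnMDl // divn_small // addn0 modnMDl modn_small.
rewrite /sgn3; case: (ltngtP a i) hs => [ai | ia | _] hs; rewrite ?andbF ?andbT.
- by rewrite muln0 subn0 expr0 mulr1 uE // mulrC.
- rewrite expr0 mulr1; case: c cl hs => [|c] cl /= hs.
    case: s hs => [/(_ isT) // | s] _.
    have -> : (s.+1 * l + 0 = (s * l + l.-1).+1)%N by lia.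
    rewrite /y uE; last by lia.
    by rewrite muln1 addn0 subn1 /= -[in RHS](prednK l0) exprS; ring.
  rewrite addnS /y uE; last by lia.
  by rewrite muln0 add0n subn0 exprS; ring.
rewrite muln0 subn0 add0n /rho uE // dvdn_addr ?dvdn_mull //.
case: c cl {hs} => [|c] cl; first by rewrite dvdn0 eqxx expr0; ring.
by rewrite gtnNdvd //= expr0; ring.
Qed.

Lemma bsum_gen_fun r : bsum K z y (rho r) u (W * l * 3) 0 = gen_fun r.
Proof.
rewrite bsum_perm //; apply: eq_bigr => n _.
rewrite (@colored_sum n l _ (fun k => z * letter_wt y (rho r) u k) W) // /stat_sum !mulr_sumr.
have nW : (n * M.+1 < W)%N by rewrite ltnS ltnW // ltnS leq_mul2r ltnW ?orbT.
apply: eq_bigr => p _.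
transitivity (z ^+ n * (t ^+ cfexc p * r ^+ cfix p) *
    \sum_(s : {ffun 'I_n -> 'I_W} | compat p s) \prod_i q ^+ (s i - exc_at p i)).
  rewrite mulr_sumr; apply: eq_bigr => s cs.
  rewrite big_split /= prodr_const card_ord -mulrA; congr (_ * _).
  have -> : cfexc p = (\sum_i (l * exc_at p i + colr p i))%N.
    by rewrite big_split /= -big_distrr /= -cexcE.
  have -> : cfix p = (\sum_i ((colr p i == 0) && (p.1 i == i)))%N.
    by rewrite /cfix -sum1dep_card big_mkcond.
  rewrite !expr_sum -!big_split /=; apply: eq_bigr => i _.
  rewrite letter_wtE // => h; exact: compat_exc cs h.
by rewrite (macmahon _ nW qM) -/(qfact_inv M q n); ring.
Qed.

Let E x := \prod_(s < W) (1 - x * q ^+ s).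

Lemma prod_u (x : R) :
  \prod_(j < W * l) (1 - x * u j) = \prod_(c < l) E (x * t ^+ c).
Proof.
rewrite (prod_div_mod W (fun s c => 1 - x * (q ^+ s * t ^+ c)) l0).
by apply: eq_bigr => c _; apply: eq_bigr => s _; rewrite [q ^+ s * _]mulrC mulrA.
Qed.

Lemma prod_rho (r : R) :
  \prod_(j < W * l) (1 - z * rho r j) = E (r * z) * \prod_(c < l.-1) E (z * t ^+ c.+1).
Proof.
transitivity (\prod_(j < W * l)
    (1 - (if (j %% l == 0)%N then r else 1) * z * (q ^+ (j %/ l)%N * t ^+ (j %% l)%N))).
  apply: eq_bigr => j _; rewrite /rho /u -/(dvdn l j) /dvdn.
  by case: ifP => _; rewrite ?mul1r // mulrCA mulrA.
rewrite (prod_div_mod W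
  (fun s c => 1 - (if (c == 0)%N then r else 1) * z * (q ^+ s * t ^+ c)) l0).
rewrite -(big_mkord xpredT
  (fun c => \prod_(s < W) (1 - (if (c == 0)%N then r else 1) * z * (q ^+ s * t ^+ c)))).
rewrite big_ltn // big_add1 big_mkord /=; congr (_ * _).
  by apply: eq_bigr => s _; rewrite expr0 mulr1.
apply: eq_bigr => c _; apply: eq_bigr => s _.
by rewrite mul1r [q ^+ s * _]mulrC mulrA.
Qed.

Hypothesis K0 : (0 < K)%N.

Lemma E_inv x : x ^+ K = 0 -> E x * qexp M K q x = 1.
Proof. by move=> xK; apply: qexp_prod => //; rewrite /W; nia. Qed.

(** The closed form depends on [r] only through [E (r * z)], which gives the first claim. For the
    second, the products for the powers [t ^+ 1] to [t ^+ l.-1], collected in [X], cancel. *)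
Lemma gen_fun_closed :
  (forall r, gen_fun r = qexp M K q (z * r) * gen_fun 0) /\
  gen_fun 0 * (qexp M K q (z * t ^+ l) - t * qexp M K q z) = 1 - t.
Proof.
have [N eN] : exists N, (W * l = N.+1)%N.
  by exists (W * l).-1; rewrite prednK // muln_gt0 l0.
have uN : u N = 0.
  have le : (M <= N %/ l)%N.
    rewrite leq_divRL //; have : (M.+2 * l <= W * l)%N by rewrite leq_mul2r /W; nia.
    by rewrite eN; lia.
  by rewrite /u -(subnKC le) exprD qM !mul0r.
have Ez x : E (z * x) * qexp M K q (z * x) = 1 by apply: E_inv; rewrite exprMn zK mul0r.
pose X := \prod_(c < l.-1) E (z * t ^+ c.+1).
pose iX := \prod_(c < l.-1) qexp M K q (z * t ^+ c.+1).
have XiX : X * iX = 1.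
  by rewrite -big_split big1 // => c _; apply: Ez.
have splitl (f : nat -> R) : \prod_(c < l) f c = f 0%N * \prod_(c < l.-1) f c.+1.
  by case: (l) l0 => // l' _; rewrite big_ord_recl.
have splitr (f : nat -> R) : \prod_(c < l) f c = \prod_(c < l.-1) f c * f l.-1.
  by case: (l) l0 => // l' _; rewrite big_ord_recr.
have prodN x : \prod_(j < N) (1 - x * u j) = \prod_(c < l) E (x * t ^+ c).
  by rewrite -prod_u eN big_ord_recr /= uN mulr0 subr0 mulr1.
have prod1 : \prod_(j < N) (1 - z * u j) = E z * X.
  by rewrite prodN (splitl (fun c => E (z * t ^+ c))) expr0 mulr1.
have prod2 : \prod_(j < N) (1 - t * (z * u j)) = X * E (z * t ^+ l).
  under eq_bigr do rewrite mulrA.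
  rewrite prodN (splitr (fun c => E (t * z * t ^+ c))); congr (_ * _).
    by apply: eq_bigr => c _; rewrite [t * z]mulrC -mulrA exprS.
  by rewrite [t * z]mulrC -mulrA -exprS prednK.
have key r := bsum_closed zK (rho r) (t := t) (erefl (y 0%N)) (fun=> erefl _) uN.
have {}key r : let d0 := pivots z y u N.+1 1 1 in
    [/\ exists i, d0 * i = 1, d0 * (E (r * z) * X) * gen_fun r = E z * X * (X * E (z * t ^+ l))
      & (1 - t) * d0 = E z * X - t * (X * E (z * t ^+ l))].
  have := key r; rewrite prod1 prod2 -eN prod_rho bsum_gen_fun; exact.
have [[i ei] key0 ed] := key 0.
move: key0; rewrite mul0r; have -> : E 0 = 1.
  by rewrite /E big1 // => s _; rewrite mul0r subr0.
rewrite mul1r => key0.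
have Ez1 := Ez 1; rewrite mulr1 in Ez1.
set d0 := pivots _ _ _ _ _ _ in key ei key0 ed.
split.
  move=> r; have [_ keyr _] := key r.
  have eE : E (r * z) * gen_fun r = gen_fun 0.
    transitivity (d0 * i * (X * iX) * (E (r * z) * gen_fun r)); first by rewrite ei XiX !mul1r.
    transitivity (i * iX * (d0 * (E (r * z) * X) * gen_fun r)); first by ring.
    rewrite keyr -key0; transitivity (d0 * i * (X * iX) * gen_fun 0); first by ring.
    by rewrite ei XiX !mul1r.
  by rewrite -eE [r * z]mulrC mulrA [qexp _ _ _ _ * _]mulrC Ez mul1r.
move: key0 ed (Ez (t ^+ l)) Ez1; move: (gen_fun 0) (E z) (qexp M K q z)
  (E (z * t ^+ l)) (qexp M K q (z * t ^+ l)).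
move=> F e h el hl key0 ed ehl eh.
transitivity (F * (e * h * hl - t * (el * hl * h))); first by rewrite ehl eh !mul1r.
transitivity (F * h * hl * (X * iX) * (e - t * el)); first by rewrite XiX; ring.
transitivity (F * h * hl * iX * (e * X - t * (X * el))); first by ring.
rewrite -ed; transitivity (h * hl * iX * (1 - t) * (X * iX) * (d0 * F)).
  by rewrite XiX; ring.
transitivity (h * hl * iX * (1 - t) * iX * (d0 * X * F)); first by ring.
rewrite key0; transitivity ((1 - t) * (e * h) * (el * hl) * (X * iX) * (X * iX)); first by ring.
by rewrite eh ehl XiX !mulr1.
Qed.

End Generating.

(** * q-binomial coefficients, and truncation of polynomials *)

Section QBinomial.
Local Open Scope ring_scope.

Fixpoint qbin (R : comNzRingType) (q : R) n k : R :=
  match n, k with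
  | _, 0 => 1
  | 0, _.+1 => 0
  | n'.+1, k'.+1 => qbin q n' k' + q ^+ k * qbin q n' k
  end.

Lemma qbinSS (R : comNzRingType) (q : R) n k :
  qbin q n.+1 k.+1 = qbin q n k + q ^+ k.+1 * qbin q n k.+1.
Proof. by []. Qed.

Definition qfact (R : comNzRingType) (q : R) n : R := \prod_(j < n) (1 - q ^+ j.+1).

Lemma qbin0 (R : comNzRingType) (q : R) n : qbin q n 0 = 1.
Proof. by case: n. Qed.

Lemma qbin_small (R : comNzRingType) (q : R) n k : (n < k)%N -> qbin q n k = 0.
Proof.
elim: n k => [|n IH] [|k] //= nk.
by rewrite !IH ?mulr0 ?addr0 // ltnW.
Qed.

Lemma qbin_fact (R : comNzRingType) (q : R) n k :
  (k <= n)%N -> qbin q n k * (qfact q k * qfact q (n - k)) = qfact q n.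
Proof.
elim: n k => [|n IH] [|k] //=.
- by rewrite /qfact !big_ord0 !mulr1.
- by rewrite subn0 /qfact big_ord0 !mul1r.
have qS m : qfact q m.+1 = qfact q m * (1 - q ^+ m.+1) by rewrite /qfact big_ord_recr.
rewrite ltnS subSS => kn; rewrite qS.
transitivity ((1 - q ^+ k.+1) * (qbin q n k * (qfact q k * qfact q (n - k))) +
  q ^+ k.+1 * (qbin q n k.+1 * (qfact q k.+1 * qfact q (n - k)))).
  by rewrite qS; ring.
rewrite IH //; move: kn; rewrite leq_eqVlt => /predU1P[-> | kn].
  by rewrite qbin_small // mul0r mulr0 addr0 qS mulrC.
have -> : (n - k = (n - k.+1).+1)%N by lia.
rewrite [qfact q (n - k.+1).+1]qS.
transitivity ((1 - q ^+ k.+1) * qfact q n + (q ^+ k.+1 - q ^+ k.+1 * q ^+ (n - k.+1).+1) *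
  (qbin q n k.+1 * (qfact q k.+1 * qfact q (n - k.+1)))).
  by ring.
rewrite IH // -exprD qS; have -> : (k.+1 + (n - k.+1).+1 = n.+1)%N by lia.
by ring.
Qed.

Lemma rmorph_qbin (R R' : comNzRingType) (f : {rmorphism R -> R'}) (q : R) n k :
  f (qbin q n k) = qbin (f q) n k.
Proof.
elim: n k => [|n IH] [|k]; rewrite ?qbin0 ?rmorph1 ?rmorph0 //.
by rewrite !qbinSS rmorphD rmorphM rmorphXn !IH.
Qed.

Lemma qfactK (R : comNzRingType) M (q : R) n : q ^+ M = 0 -> qfact q n * qfact_inv M q n = 1.
Proof.
move=> qM; elim: n => [|n IH]; first by rewrite /qfact /qfact_inv !big_ord0 mulr1.
by rewrite /qfact big_ord_recr /= -mulrA qfact_invS.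
Qed.

Lemma rmorph_qfact_inv (R R' : comNzRingType) (f : {rmorphism R -> R'}) M (q : R) n :
  f (qfact_inv M q n) = qfact_inv M (f q) n.
Proof.
rewrite rmorph_prod; apply: eq_bigr => j _; rewrite rmorph_sum.
by apply: eq_bigr => d _; rewrite rmorphXn.
Qed.

Lemma qbin_qfact_inv (R : comNzRingType) M (q : R) n k : q ^+ M = 0 -> (k <= n)%N ->
  qfact q n * (qfact_inv M q k * qfact_inv M q (n - k)) = qbin q n k.
Proof.
move=> qM kn; rewrite -(qbin_fact q kn).
transitivity (qbin q n k * (qfact q k * qfact_inv M q k) *
  (qfact q (n - k) * qfact_inv M q (n - k))); first by ring.
by rewrite !qfactK // !mulr1.
Qed.

Lemma rmorph_stat_sum (R R' : comNzRingType) (f : {rmorphism R -> R'}) l (q t : R) n r :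
  f (stat_sum l q t n r) = stat_sum l (f q) (f t) n (f r).
Proof. by rewrite rmorph_sum; apply: eq_bigr => p _; rewrite !rmorphM !rmorphXn. Qed.

Definition fix_sum (R : comNzRingType) l (q t : R) n j : R :=
  \sum_(p : cperm n l | cfix p == j) t ^+ cfexc p * q ^+ (cmaj p - cexc p).

Lemma rmorph_fix_sum (R R' : comNzRingType) (f : {rmorphism R -> R'}) l (q t : R) n j :
  f (fix_sum l q t n j) = fix_sum l (f q) (f t) n j.
Proof. by rewrite rmorph_sum; apply: eq_bigr => p _; rewrite rmorphM !rmorphXn. Qed.

Lemma stat_sum0 (R : comNzRingType) l (q t : R) n : stat_sum l q t n 0 = fix_sum l q t n 0.
Proof.
rewrite [RHS]big_mkcond; apply: eq_bigr => p _; rewrite expr0n.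
by case: eqP => _; rewrite ?mulr1 // mulr0 mul0r.
Qed.

Lemma coef_stat_sum (R : comNzRingType) l (q t : R) n j :
  (stat_sum l q%:P t%:P n 'X)`_j = fix_sum l q t n j.
Proof.
rewrite coef_sum [RHS]big_mkcond; apply: eq_bigr => p _.
rewrite -!rmorphXn -mulrA coefCM coefMC coefXn eq_sym.
by case: eqP => _; rewrite ?mul1r // mul0r mulr0.
Qed.

(** The quotient by ['X^K] makes the variable nilpotent and keeps the coefficients below [K], so
    results on nilpotent variables transfer to polynomials. *)
Lemma truncation (A : comNzRingType) K : (0 < K)%N ->
  exists (B : comNzRingType) (f : {rmorphism {poly A} -> B}),
    f 'X ^+ K = 0 /\ forall p p', f p = f p' -> forall n, (n < K)%N -> p`_n = p'`_n.
Proof.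
move=> K0; exists {poly %/ 'X^K : {poly A}}, (in_qpoly ('X^K : {poly A})).
have XK : mk_monic 'X^K = 'X^K :> {poly A} by rewrite mk_monic_Xn prednK.
have XKm : 'X^K \is @monic A by apply: monicXn.
split.
  by apply/val_inj; rewrite -rmorphXn /= XK Pdiv.RingMonic.rmodpp.
move=> p p' /(congr1 val); rewrite /= XK => e n nK.
rewrite (Pdiv.RingMonic.rdivp_eq XKm p) (Pdiv.RingMonic.rdivp_eq XKm p') e.
by rewrite !coefD !coefMXn nK.
Qed.

(** * Recursions read off the generating function *)

Section Recursion.
Variables (R : comNzRingType) (M l : nat) (q t : R).
Hypotheses (qM : q ^+ M = 0) (l0 : (0 < l)%N).

Let h := qfact_inv M q.
Let a n j := fix_sum l q t n j.

(** The coefficients of [z ^+ n] are compared in both parts of [gen_fun_closed] and multiplied by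
    [qfact q n]; in the first part those of [r ^+ j] are compared as well. *)
Lemma fix_sum_recursions n :
  (forall j, (j <= n)%N -> a n j = qbin q n j * a (n - j) 0) /\
  \sum_(j < n.+1) qbin q n j * (t ^+ (l * j) - t) * a (n - j) 0 = (1 - t) *+ (n == 0)%N.
Proof.
(* The inner polynomial variable is [r], marking fixed points; the outer one, truncated, is [z]. *)
have [S [f [fK fP]]] := @truncation {poly R} n.+1 isT.
pose z := f 'X; pose i : {rmorphism {poly R} -> S} := f \o polyC.
pose c : {rmorphism R -> S} := i \o polyC.
have cM : c q ^+ M = 0 by rewrite -rmorphXn qM rmorph0.
have [g1 g2] := gen_fun_closed (c t) fK cM l0 isT.
pose G r := \poly_(k < n.+1) ((h k)%:P * stat_sum l q%:P t%:P k r).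
pose H x := \poly_(k < n.+2) ((h k)%:P * x ^+ k).
have fG r : f (G r) = gen_fun n.+1 M l z (c q) (c t) (i r).
  rewrite /G poly_def rmorph_sum; apply: eq_bigr => k _.
  rewrite -mul_polyC rmorphM rmorphXn mulrC /= polyCM rmorphM /=.
  by rewrite -[f (stat_sum _ _ _ _ _)%:P]/(i _) rmorph_stat_sum -[f _%:P]/(c _) rmorph_qfact_inv.
have fH x : f (H x) = qexp M n.+1 (c q) (z * i x).
  rewrite /H poly_def rmorph_sum; apply: eq_bigr => k _.
  rewrite -mul_polyC rmorphM rmorphXn /= polyCM rmorphM /= exprMn [z ^+ _ * _]mulrC mulrA.
  by rewrite -[f _%:P]/(c _) rmorph_qfact_inv rmorphXn rmorphXn.
have {}g1 : f (G 'X) = f (H 'X * G 0).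
  by rewrite rmorphM !fG fH g1 rmorph0.
have {}g2 : f (G 0 * (H (t ^+ l)%:P - t%:P%:P * H 1)) = f (1 - t%:P)%:P.
  rewrite !(rmorphM, rmorphB) /= fG !fH rmorph0 rmorph1 mulr1 rmorph1.
  rewrite -[i _]/(c _) rmorphXn; exact: g2.
have coefG r k : (k < n.+1)%N -> (G r)`_k = (h k)%:P * stat_sum l q%:P t%:P k r.
  by move=> kn; rewrite coef_poly kn.
have coefH x k : (k < n.+1)%N -> (H x)`_k = (h k)%:P * x ^+ k.
  by move=> kn; rewrite coef_poly ltnS ltnW.
have st0 k : stat_sum l q%:P t%:P k 0 = (a k 0)%:P.
  by rewrite stat_sum0 /a rmorph_fix_sum.
have le (k : 'I_n.+1) : (n - k < n.+1)%N by rewrite ltnS leq_subr.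
split=> [j jn|].
  have := fP _ _ g1 n (ltnSn n); rewrite coefM coefG //.
  under eq_bigr => k _ do rewrite coefH // coefG // st0.
  move/(congr1 (fun p : {poly R} => p`_j)); rewrite coefCM coef_stat_sum coef_sum.
  rewrite (bigD1 (Ordinal (jn : j < n.+1)%N)) //= big1 ?addr0; last first.
    move=> k; rewrite -val_eqE /= => /negbTE jk.
    by rewrite mulrA coefMC coefMC coefCM coefXn eq_sym jk mulr0 !mul0r.
  rewrite mulrA coefMC coefMC coefCM coefXn eqxx mulr1 => e.
  rewrite -[a n j]mul1r -(qfactK n qM) -mulrA -/(h n) e -(qbin_qfact_inv qM jn).
  by rewrite /h; ring.
have := fP _ _ g2 n (ltnSn n); rewrite coefC coefMr.
under eq_bigr => k _.
  rewrite coefG // st0 coefB coefCM !coefH // expr1n mulr1 -rmorphXn -!rmorphM -rmorphB -rmorphM.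
  over.
rewrite -rmorph_sum => /(congr1 (fun p : {poly R} => p`_0)); rewrite coefC eqxx /= => e.
transitivity (qfact q n * (if n == 0%N then 1 - t else 0)); last first.
  by case: eqP => [->|_]; rewrite ?mulr0 // /qfact big_ord0 mul1r.
have -> : (if n == 0%N then 1 - t else 0) = (if n == 0%N then 1 - t%:P else 0)`_0.
  by case: eqP => _; rewrite ?coef0 // coefB coef1 coefC.
rewrite -e mulr_sumr; apply: eq_bigr => k _.
have kn : (k <= n)%N by rewrite -ltnS.
by rewrite -(qbin_qfact_inv qM kn) exprM /h; ring.
Qed.

End Recursion.

End QBinomial.

(** * Recursions over the integers *)

Section Exact.
Local Open Scope ring_scope.
Variable l : nat.
Hypothesis l0 : (0 < l)%N.

Local Notation Zqt := {poly {poly int}}.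
Let q : Zqt := 'X.
Let t : Zqt := 'X%:P.

(** The variable [q] is now free; the coefficient of [q ^+ e] is compared after truncation at
    [e.+1]. *)
Lemma fix_sum_qbin n j : (j <= n)%N ->
  fix_sum l q t n j = qbin q n j * fix_sum l q t (n - j) 0.
Proof.
move=> jn; apply/polyP => e.
have [B [f [fM fP]]] := @truncation {poly int} e.+1 isT.
apply: (fP) (ltnSn e); rewrite rmorphM rmorph_qbin !rmorph_fix_sum.
by have [H _] := fix_sum_recursions (f t) fM l0 n; apply: H.
Qed.

Lemma one_sub_t_neq0 : 1 - t != 0.
Proof.
rewrite -[1]/(1%:P) -rmorphB polyC_eq0 subr_eq0 eq_sym.
by apply/eqP => /(congr1 (fun p : {poly int} => p`_1)); rewrite coefX coef1.
Qed.

Lemma fix_sum_telescope n : (0 < n)%N ->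
  \sum_(j < n.+1) qbin q n j * (t ^+ (l * j) - t) * fix_sum l q t (n - j) 0 = 0.
Proof.
move=> n0; apply/polyP => e; have [B [f [fM fP]]] := @truncation {poly int} e.+1 isT.
apply: (fP) (ltnSn e); rewrite rmorph0 rmorph_sum.
have [_] := fix_sum_recursions (f t) fM l0 n; rewrite (gtn_eqF n0) mulr0n => H.
apply: etrans H; apply: eq_bigr => j _.
by rewrite !(rmorphM, rmorphB, rmorphXn) rmorph_qbin rmorph_fix_sum.
Qed.

(** The term [j = 0] of [fix_sum_telescope] has the factor [1 - t], and [1 - t] divides the factors
    of the other terms. *)
Lemma fix_sum_rec n : (0 < n)%N ->
  fix_sum l q t n 0 =
  \sum_(j < n) qbin q n j.+1 * ('X * \sum_(i < l * j.+1 - 1) 'X^i)%:P * fix_sum l q t (n - j.+1) 0.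
Proof.
move=> n0; have e := fix_sum_telescope n0.
apply: (mulfI one_sub_t_neq0); move: e; rewrite big_ord_recl; under eq_bigr do rewrite lift0.
rewrite /= muln0 expr0 qbin0 mul1r subn0.
move/eqP; rewrite addr_eq0 => /eqP ->; rewrite mulr_sumr -sumrN; apply: eq_bigr => j _.
have -> : t ^+ (l * j.+1) - t = - (1 - t) * ('X * \sum_(i < l * j.+1 - 1) 'X^i)%:P.
  rewrite /t -rmorphXn -(rmorph1 polyC) -!rmorphB -rmorphN -rmorphM; congr polyC.
  rewrite opprB mulrCA -subrX1 mulrBr mulr1 -exprS.
  have -> : (l * j.+1 - 1).+1 = (l * j.+1)%N by rewrite subn1 prednK // muln_gt0 l0.
  by [].
by ring.
Qed.

Lemma cfix_le n (p : cperm n l) : (cfix p <= n)%N.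
Proof. by rewrite -[X in (_ <= X)%N]card_ord max_card. Qed.

Lemma stat_sum1E n : stat_sum l q t n 1 = \sum_(j < n.+1) fix_sum l q t n j.
Proof.
rewrite /stat_sum /fix_sum (partition_big (fun p => inord (cfix p) : 'I_n.+1) xpredT) //=.
apply: eq_bigr => j _; apply: eq_big => [p | p _]; last by rewrite expr1n mulr1.
by rewrite -val_eqE /= inordK // ltnS cfix_le.
Qed.

(** Subtracting the vanishing sum turns each factor [1 - t] into [(1 - t) - (t ^+ (l * j) - t) = 1 -
    t ^+ (l * j)]. *)
Lemma stat_sum1_rec n : (0 < n)%N ->
  stat_sum l q t n 1 =
  \sum_(j < n) qbin q n j.+1 * (\sum_(i < l * j.+1) 'X^i)%:P * fix_sum l q t (n - j.+1) 0.
Proof.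
move=> n0; have e := fix_sum_telescope n0.
have geo m : (1 - t) * (\sum_(i < m) 'X^i)%:P = 1 - t ^+ m.
  rewrite /t -rmorphXn -(rmorph1 polyC) -!rmorphB -rmorphM; congr polyC.
  by rewrite -opprB mulNr -subrX1 opprB.
apply: (mulfI one_sub_t_neq0); rewrite stat_sum1E mulr_sumr.
transitivity (\sum_(j < n.+1) ((1 - t) * fix_sum l q t n j -
    qbin q n j * (t ^+ (l * j) - t) * fix_sum l q t (n - j) 0)).
  by rewrite sumrB e subr0.
rewrite big_ord_recl [X in X + _](_ : _ = 0); last first.
  by rewrite muln0 expr0 qbin0 mul1r subn0 subrr.
rewrite [LHS]add0r.
rewrite mulr_sumr; apply: eq_bigr => j _; rewrite lift0 fix_sum_qbin //.
transitivity (qbin q n j.+1 * (1 - t ^+ (l * j.+1)) * fix_sum l q t (n - j.+1) 0); first by ring.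
by rewrite -geo; ring.
Qed.

End Exact.

(** * Symmetry and unimodality *)

Section Unimodal.
Import Num.Theory Order.TTheory.
Local Open Scope ring_scope.
Implicit Types (f g : {poly int}) (c m : nat).

(** The center is half of [c]. The support need not fill the range from 0 to [c] and zero is
    allowed, which makes the property stable under sums. *)
Record sym_unimodal c f : Prop := SymUnimodal {
  su_ge0 : forall i, 0 <= f`_i;
  su_gt : forall i, (c < i)%N -> f`_i = 0;
  su_sym : forall i, (i <= c)%N -> f`_i = f`_(c - i);
  su_step : forall i, (i.*2.+2 <= c)%N -> f`_i <= f`_i.+1
}.

Lemma su_le c f i j : sym_unimodal c f -> (i <= j)%N -> (i + j <= c)%N -> f`_i <= f`_j.
Proof.
move=> sf.
have low k : (i <= k)%N -> (k.*2 <= c)%N -> f`_i <= f`_k.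
  elim: k => [|k IH]; first by rewrite leqn0 => /eqP ->.
  rewrite leq_eqVlt => /predU1P[-> // | ik] kc.
  by apply: le_trans (su_step sf _); [apply: IH => //; lia | rewrite doubleS in kc].
move=> ij ijc; case: (leqP j.*2 c) => [|jc]; first exact: low.
by rewrite (su_sym sf (i := j)) ?low //; lia.
Qed.

Lemma su0 c : sym_unimodal c 0.
Proof. by split=> *; rewrite !coef0. Qed.

Lemma suD c f g : sym_unimodal c f -> sym_unimodal c g -> sym_unimodal c (f + g).
Proof.
move=> sf sg; split=> i => [|ic|ic|ic]; rewrite !coefD.
- by rewrite addr_ge0 ?(su_ge0 sf) ?(su_ge0 sg).
- by rewrite (su_gt sf) // (su_gt sg).
- by rewrite (su_sym sf) // (su_sym sg).
by rewrite lerD ?(su_step sf) ?(su_step sg).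
Qed.

Lemma su_sum c I (r : seq I) (C : pred I) (F : I -> {poly int}) :
  (forall i, C i -> sym_unimodal c (F i)) -> sym_unimodal c (\sum_(i <- r | C i) F i).
Proof. by move=> H; apply: big_ind => //; [apply: su0 | apply: suD]. Qed.

Lemma suMnat c f k : sym_unimodal c f -> sym_unimodal c (k%:R * f).
Proof. move=> sf; rewrite mulr_natl; elim: k => [|k IH]; first by rewrite mulr0n; apply: su0.
by rewrite mulrS; apply: suD. Qed.

Lemma suX c f : sym_unimodal c f -> sym_unimodal c.+2 ('X * f).
Proof.
move=> sf; split=> -[|i] => [||ic|ic|ic|ic|ic|ic]; rewrite !coefXM //=.
- exact: (su_ge0 sf).
- by rewrite (su_gt sf) //; lia.
- by rewrite (su_gt sf).
- case: eqP => ne; first by rewrite (su_gt sf) //; lia.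
  by rewrite (su_sym sf); [congr (f`_ _); lia | lia].
- exact: (su_ge0 sf).
by apply: (su_step sf); lia.
Qed.

Lemma coef_window m f k :
  ((\sum_(a < m) 'X^a) * f)`_k = \sum_(a < m) if (k < a)%N then 0 else f`_(k - a).
Proof. by rewrite mulr_suml coef_sum; apply: eq_bigr => a _; rewrite coefXnM. Qed.

(** Multiplication by [1 - 'X] turns the window into [1 - 'X^m]. So consecutive coefficients of the
    product differ by a difference of two coefficients of [f] at distance [m], and in the lower half
    the smaller index is at least as far from the center. *)
Lemma su_window c f m : (0 < m)%N -> sym_unimodal c f ->
  sym_unimodal (c + m.-1) ((\sum_(a < m) 'X^a) * f).
Proof.
move=> m0 sf; split=> i.
- by rewrite coef_window sumr_ge0 // => a _; case: ifP => // _; exact: (su_ge0 sf).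
- move=> ic; rewrite coef_window big1 // => a _; case: ifP => // _.
  by apply: (su_gt sf); have := ltn_ord a; lia.
- move=> ic; rewrite !coef_window [RHS](reindex_inj rev_ord_inj) /=.
  apply: eq_bigr => a _; have am := ltn_ord a.
  case: ltnP => ia; case: ltnP => ica //.
  + by rewrite (su_gt sf) //; lia.
  + by rewrite (su_gt sf) //; lia.
  case: (leqP (i - a) c) => iac; last by rewrite !(su_gt sf) //; lia.
  by rewrite (su_sym sf) //; congr (f`_ _); lia.
move=> ic; set g := _ * f.
have : ((1 - 'X) * g)`_i.+1 = ((1 - 'X^m) * f)`_i.+1.
  by rewrite mulrA -opprB mulNr -subrX1 opprB.
rewrite !mulrBl !mul1r !coefB coefXM coefXnM /= => e.
rewrite -subr_ge0 e subr_ge0; case: ltnP => im; first exact: (su_ge0 sf).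
by apply: (su_le sf); lia.
Qed.

Local Notation Zqt := {poly {poly int}}.
Implicit Types P : Zqt.

Definition qsu c P := forall e, sym_unimodal c P`_e.

Lemma qsu_sum c I (r : seq I) (C : pred I) (F : I -> Zqt) :
  (forall i, C i -> qsu c (F i)) -> qsu c (\sum_(i <- r | C i) F i).
Proof. by move=> H e; rewrite coef_sum; apply: su_sum => i Ci; apply: H. Qed.

Lemma coef_qbin n k e : exists b : nat, (qbin ('X : Zqt) n k)`_e = b%:R.
Proof.
elim: n k e => [|n IH] [|k] e; rewrite ?qbin0.
- by exists (e == 0)%N; rewrite coef1.
- by exists 0%N; rewrite coef0.
- by exists (e == 0)%N; rewrite coef1.
rewrite qbinSS coefD coefXnM; have [b ->] := IH k e; case: ltnP => _.
  by exists b; rewrite addr0.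
by have [b' ->] := IH k.+1 (e - k.+1)%N; exists (b + b')%N; rewrite natrD.
Qed.

Lemma qbin_coef0 n k : (k <= n)%N -> (qbin ('X : Zqt) n k)`_0 = 1.
Proof.
elim: n k => [|n IH] [|k] // kn; rewrite ?qbin0 ?coef1 //.
by rewrite qbinSS coefD coefXnM /= addr0 IH.
Qed.

Lemma qsu_qbin c n k P : qsu c P -> qsu c (qbin 'X n k * P).
Proof.
move=> sP e; rewrite coefM; apply: su_sum => i _.
by have [b ->] := coef_qbin n k i; apply: suMnat.
Qed.

(** If [r] is the lowest degree in [t], the highest is [c - r] by symmetry, so the actual range has
    the required center. The positive coefficient ensures that [r] exists. *)
Lemma sym_unimodal_spec c P (a : nat -> int -> nat) :
  (forall k e, (a k (Posz e))%:Z = P`_e`_k) -> (forall k e, a k (Negz e) = 0%N) ->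
  qsu c P -> (exists k, 0 < P`_0`_k) -> t_symmetric a c /\ t_unimodal a.
Proof.
move=> aP aN sP [k0 pos].
have agt k e : (c < k)%N -> a k e = 0%N.
  by case: e => e ck; rewrite ?aN //; apply/eqP; rewrite -eqz_nat aP (su_gt (sP e)).
have asym k e : (k <= c)%N -> a k e = a (c - k)%N e.
  by case: e => e ck; rewrite ?aN //; apply/eqP; rewrite -eqz_nat !aP -(su_sym (sP e)).
have astep k e : (k.*2.+2 <= c)%N -> (a k e <= a k.+1 e)%N.
  by case: e => e ck; rewrite ?aN // -lez_nat !aP (su_step (sP e)).
(* Only exponents of [q] below [size P] can occur, so nonvanishing is decidable. *)
pose nz k := has (fun e => a k (Posz e) != 0%N) (iota 0 (size P)).
have nzP k : reflect (exists e, a k e <> 0%N) (nz k).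
  apply: (iffP hasP) => [[e _ /eqP ae]|[[e|e] ae]]; first by exists (Posz e).
    exists e; last exact/eqP.
    rewrite mem_iota /= add0n ltnNge; apply/negP => le; apply: ae; apply/eqP.
    by rewrite -eqz_nat aP (nth_default _ le) coef0.
  by rewrite aN in ae.
have ex : exists k, nz k.
  by exists k0; apply/nzP; exists (Posz 0) => a0; rewrite -aP a0 in pos.
case: (ex_minnP ex) => r /nzP nr rmin.
have low k e : (k < r)%N -> a k e = 0%N.
  move=> kr; apply/eqP; apply: contraT => /eqP ae.
  by have := rmin k; rewrite leqNgt kr => /(_ (introT (nzP k) (ex_intro _ e ae))).
have rc : (r <= c)%N.
  by case: nr => e ae; rewrite leqNgt; apply/negP => cr; apply: ae; apply: agt.
have ns : nzq (a (c - r)%N) by case: nr => e ae; exists e; rewrite -asym.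
have rs : (r <= c - r)%N by apply: rmin; apply/nzP.
have range : tdeg_range a r (c - r).
  split=> // k [kr e|kr e]; first exact: low.
  by case: (leqP k c) => [kc|/agt //]; rewrite asym // low //; lia.
have rsc : (r + (c - r) = c)%N by lia.
split; exists r, (c - r)%N; split=> //.
- by move=> k kr e; rewrite asym; [congr (a _ e); lia | lia].
- by rewrite rsc => k _ kc e; apply: astep; lia.
rewrite rsc => k kc ks e; rewrite asym; last by lia.
rewrite [leqRHS]asym; last by lia.
have -> : (c - k = (c - k.+1).+1)%N by lia.
by apply: astep; lia.
Qed.

Variable l : nat.
Hypothesis l0 : (0 < l)%N.

Local Notation D n := (fix_sum l ('X : Zqt) 'X%:P n 0).

Lemma fix_sum00 : D 0 = 1.
Proof.
rewrite /fix_sum (eq_bigl xpredT) => [|p]; last first.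
  by rewrite -leqn0; apply: cfix_le.
rewrite (eq_bigr (fun=> 1)) => [|p _]; last first.
  have z m : (m <= 0)%N -> m = 0%N by case: m.
  have -> : cexc p = 0%N by rewrite cexcE big_ord0.
  have -> : cmaj p = 0%N by rewrite /cmaj big_ord0.
  by rewrite /cfexc cexcE !big_ord0 muln0 !expr0 mulr1.
by rewrite sumr_const card_prod card_Sn card_ffun !card_ord fact0 expn0.
Qed.

(** With [k = j.+1], the factor ['X], the window of length [l * k - 1] and [D (n - k)] contribute
    [2 + (l * k - 2) + l * (n - k) = l * n]. An empty window gives a zero term. *)
Lemma qsu_derangements n : qsu (l * n) (D n).
Proof.
have [k] := ubnP n; elim: k n => // k IH [|n] nk.
  rewrite fix_sum00 => e; rewrite coef1 muln0; case: eqP => _ /=; last exact: su0.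
  by split=> -[|i] //= *; rewrite ?coef1.
rewrite fix_sum_rec //; apply: qsu_sum => j _ e.
rewrite -mulrA; apply: qsu_qbin => {}e; rewrite coefCM.
have jn := ltn_ord j.
have sD := IH (n.+1 - j.+1)%N (ltac:(lia)) e.
have [m0|m0] := posnP (l * j.+1 - 1).
  by rewrite m0 big_ord0 mulr0 mul0r; apply: su0.
have -> : (l * n.+1 = (l * (n.+1 - j.+1) + (l * j.+1 - 1).-1).+2)%N.
  by rewrite mulnBr; have : (l * j.+1 <= l * n.+1)%N by [rewrite leq_mul2l jn orbT]; lia.
by rewrite -mulrA; apply: suX; apply: su_window.
Qed.

Lemma qsu_fix_sum n j : (j <= n)%N -> qsu (l * (n - j)) (fix_sum l ('X : Zqt) 'X%:P n j).
Proof.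
by move=> jn; rewrite fix_sum_qbin //; apply: qsu_qbin; apply: qsu_derangements.
Qed.

(** Here the count is [(l * k - 1) + l * (n - k) = l * n - 1] with [k = j.+1]. *)
Lemma qsu_stat_sum n : (0 < n)%N -> qsu (l * n - 1) (stat_sum l ('X : Zqt) 'X%:P n 1).
Proof.
move=> n0; rewrite stat_sum1_rec //; apply: qsu_sum => j _ e.
rewrite -mulrA; apply: qsu_qbin => {}e; rewrite coefCM.
have jn := ltn_ord j.
have lj : (0 < l * j.+1)%N by rewrite muln_gt0 l0.
have -> : (l * n - 1 = l * (n - j.+1) + (l * j.+1).-1)%N.
  by rewrite mulnBr; have : (l * j.+1 <= l * n)%N by [rewrite leq_mul2l jn orbT]; lia.
by apply: su_window => //; apply: qsu_derangements.
Qed.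

(** At [q = 0] the q-binomials become 1, and the last term is [w n] since [D 0 = 1]; the other terms
    are nonnegative. *)
Lemma qbin_sum_gt0 n (w : nat -> {poly int}) k :
  (forall j i, 0 <= (w j)`_i) -> 0 < (w n)`_k ->
  0 < (\sum_(j < n.+1) qbin 'X n.+1 j.+1 * (w j)%:P * D (n.+1 - j.+1))`_0`_k.
Proof.
move=> w0 wn.
pose F j := qbin ('X : Zqt) n.+1 j.+1 * (w j)%:P * D (n.+1 - j.+1).
have FE j : (j < n.+1)%N -> (F j)`_0 = w j * (D (n.+1 - j.+1))`_0.
  by move=> jn; rewrite /F coef0M coefMC qbin_coef0 // mul1r.
rewrite -(big_mkord xpredT F) big_nat_recr //= coefD coefD FE // subnn fix_sum00 coef1 mulr1.
apply: ltr_wpDl wn; rewrite big_mkord !coef_sum; apply: sumr_ge0 => j _.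
have jn : (j < n.+1)%N by rewrite ltnS ltnW.
rewrite (FE _ jn) coefM; apply: sumr_ge0 => i _; apply: mulr_ge0; first exact: w0.
exact: (su_ge0 (qsu_derangements (n.+1 - j.+1) 0)).
Qed.

Lemma derangements_gt0 n : n = 0%N \/ (1 < l * n)%N -> exists k, 0 < (D n)`_0`_k.
Proof.
case: n => [_|n [//|ln]]; first by exists 0%N; rewrite fix_sum00 coef1 /= coef1.
exists 1%N; rewrite fix_sum_rec //.
apply: (qbin_sum_gt0 (w := fun j => 'X * \sum_(i < l * j.+1 - 1) 'X^i)) => [j i|].
  rewrite coefXM; case: eqP => // _; rewrite coef_sum sumr_ge0 // => a _.
  by rewrite coefXn; case: eqP.
rewrite coefXM /= (_ : (l * n.+1 - 1 = (l * n.+1 - 2).+1)%N); last by lia.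
by rewrite big_ord_recl coefD coefXn coef_sum big1 // => i _; rewrite coefXn.
Qed.

Lemma stat_sum_gt0 n : (0 < n)%N -> exists k, 0 < (stat_sum l ('X : Zqt) 'X%:P n 1)`_0`_k.
Proof.
case: n => // n _; exists 0%N; rewrite stat_sum1_rec //.
apply: (qbin_sum_gt0 (w := fun j => \sum_(i < l * j.+1) 'X^i)) => [j i|].
  by rewrite coef_sum sumr_ge0 // => a _; rewrite coefXn; case: eqP.
have : (0 < l * n.+1)%N by rewrite muln_gt0 l0.
case: (l * n.+1)%N => // m _.
by rewrite big_ord_recl coefD coefXn coef_sum big1 // => i _; rewrite coefXn.
Qed.

Lemma statistic_coef n (p : cperm n l) (e k : nat) :
  ('X%:P ^+ cfexc p * 'X^(cmaj p - cexc p) : Zqt)`_e`_k =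
  ((cfexc p == k) && ((Posz (cmaj p) - Posz (cexc p))%R == Posz e))%:R.
Proof.
have le := cexc_le_cmaj p (ltnSn (n * 1)).
rewrite -rmorphXn coefCM coefXn subzn // eqz_nat [e == _]eq_sym andbC.
case: eqP => _ /=; last by rewrite mulr0 coef0.
by rewrite mulr1 coefXn eq_sym.
Qed.

Lemma coef_fix_sum n j k e :
  (coef_fix n l j k (Posz e))%:Z = (fix_sum l ('X : Zqt) 'X%:P n j)`_e`_k.
Proof.
rewrite /coef_fix -natz -sum1dep_card natr_sum /fix_sum !coef_sum.
rewrite big_mkcondr; apply: eq_bigr => p _.
by rewrite statistic_coef; case: ifP.
Qed.

Lemma coef_A_sum n k e :
  (coef_A n l k (Posz e))%:Z = (stat_sum l ('X : Zqt) 'X%:P n 1)`_e`_k.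
Proof.
rewrite /coef_A -natz -sum1dep_card natr_sum /stat_sum !coef_sum.
rewrite big_mkcond; apply: eq_bigr => p _.
by rewrite expr1n mulr1 statistic_coef; case: ifP.
Qed.

Lemma maj_sub_exc_neq n (p : cperm n l) e :
  ((Posz (cmaj p) - Posz (cexc p))%R == Negz e) = false.
Proof. by rewrite subzn // (cexc_le_cmaj p (ltnSn (n * 1))). Qed.

(** For [l = 1] no permutation has exactly [n.-1] fixed points when [n] is positive, so the
    polynomial is zero in that case and has no range of degrees. *)
Lemma fix_sum_gt0 n j : (j <= n)%N -> (1 < l)%N \/ j <> n.-1 ->
  exists k, 0 < (fix_sum l ('X : Zqt) 'X%:P n j)`_0`_k.
Proof.
move=> jn h; rewrite fix_sum_qbin // coef0M qbin_coef0 // mul1r.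
apply: derangements_gt0; case: (posnP (n - j)) => nj; [by left | right].
by case: h => [l1|ne]; nia.
Qed.

End Unimodal.

Theorem theorem4p12 (l n : nat) : 0 < l -> 0 < n ->
  (forall j, j <= n -> (1 < l \/ j <> n.-1) ->
     t_symmetric (coef_fix n l j) (l * (n - j)) /\ t_unimodal (coef_fix n l j)) /\
  (t_symmetric (coef_A n l) (l * n - 1) /\ t_unimodal (coef_A n l)).
Proof.
move=> l0 n0; split=> [j jn h|].
  apply: (sym_unimodal_spec (P := fix_sum l 'X%R ('X%:P)%R n j)).
  - by move=> k e; apply: coef_fix_sum.
  - by move=> k e; apply: eq_card0 => p; rewrite !inE maj_sub_exc_neq !andbF.
  - exact: qsu_fix_sum.
  - exact: fix_sum_gt0.
apply: (sym_unimodal_spec (P := stat_sum l 'X%R ('X%:P)%R n 1%R)).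
- by move=> k e; apply: coef_A_sum.
- by move=> k e; apply: eq_card0 => p; rewrite !inE maj_sub_exc_neq andbF.
- exact: qsu_stat_sum.
- exact: stat_sum_gt0.
Qed.
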